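(* Let $p$ be a prime number. Then every non-torus Lagrangian Gelfand-Cetlin fiber of the complex Grassmannian $\mathrm{Gr}(2,p)\cong\mathcal{O}_\lambda$, where $\lambda=(t,t,0,\dots,0)$ (with $p$ entries, $t>0$), is displaceable.
   Context: $\mathcal{O}_\lambda$ is the set of $p\times p$ Hermitian matrices with spectrum $\lambda$, with the Kirillov-Kostant-Souriau symplectic form $(\omega_\lambda)_h([X,h],[Y,h])=\mathrm{tr}(ih[X,Y])$ for skew-Hermitian $X,Y$. For $i,j\ge1$, $i+j\le p+1$, $\Phi_\lambda^{i,j}(x)$ is the $i$-th largest eigenvalue of the leading principal $(i+j-1)\times(i+j-1)$ submatrix of $x$; the Gelfand-Cetlin system $\Phi_\lambda$ is the tuple of all non-constant $\Phi_\lambda^{i,j}$, and a Gelfand-Cetlin fiber is a set $\Phi_\lambda^{-1}(\mathbf{u})$ with $\mathbf{u}$ in the image $\Delta_\lambda$. A non-torus Lagrangian fiber is a fiber which is a Lagrangian submanifold not diffeomorphic to a torus. A subset $Y$ of a symplectic manifold $(M,\omega)$ is displaceable if there is a Hamiltonian diffeomorphism $\phi\in\mathrm{Ham}(M,\omega)$ with $\phi(Y)\cap\overline{Y}=\emptyset$. *)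

(* Defs.v *)
From HB Require Import structures.
From mathcomp Require Import all_boot all_order all_algebra.
From mathcomp Require Import sesquilinear spectral.
From mathcomp Require Import complex.
From mathcomp Require Import all_classical all_reals all_analysis.
Set Implicit Arguments.
Unset Strict Implicit.
Unset Printing Implicit Defensive.
Import Order.TTheory GRing.Theory Num.Theory numFieldNormedType.Exports.
Local Open Scope classical_set_scope.
Local Open Scope ring_scope.

Section SmoothSubsets.
Variables (R : realType).

(* For finite-dimensional U this is the usual class C^k on the open set W. *)
Fixpoint class_C (U V : normedModType R) (k : nat) (W : set U) (f : U -> V)
    {struct k} : Prop :=
  if k is k'.+1 then
    (forall x, W x -> differentiable f x) /\
    (forall v, class_C k' W (fun x => 'D_v f x))
  else forall x, W x -> {for x, continuous f}.

(* Smoothness on an arbitrary subset: local extendability to a C^oo map of the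
   ambient space. On an embedded submanifold this is intrinsic smoothness. *)
Definition smooth_on (U V : normedModType R) (S : set U) (f : U -> V) : Prop :=
  forall x, S x -> exists (W : set U) (g : U -> V),
    [/\ open W, W x, (forall k, class_C k W g) &
        forall y, S y -> W y -> f y = g y].

Definition diffeomorphic (U V : normedModType R) (A : set U) (B : set V) :
    Prop :=
  exists (f : U -> V) (g : V -> U),
    [/\ smooth_on A f, smooth_on B g,
        (forall x, A x -> B (f x) /\ g (f x) = x) &
        (forall y, B y -> A (g y) /\ f (g y) = y)].

(* Embedded d-dimensional submanifolds (without boundary) of U. *)
Definition submanifold (U : normedModType R) (d : nat) (M : set U) : Prop :=
  forall x, M x -> exists (W : set U) (V : set 'rV[R]_d),
    [/\ open W, W x, open V & diffeomorphic (M `&` W) V].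

Definition smooth_curve (U : normedModType R) (M : set U) (x : U)
    (c : R^o -> U) : Prop :=
  [/\ smooth_on setT c, (forall s, M (c s)) & c 0 = x].

Definition tangent (U : normedModType R) (M : set U) (x : U) : set U :=
  [set v | exists c, smooth_curve M x c /\ is_derive (0 : R^o) 1 c v].

(* The row k of z is a point of the unit circle of R^2; torus 0 is a point. *)
Definition torus (n : nat) : set 'M[R]_(n, 2) :=
  [set z | forall k, z k ord0 ^+ 2 + z k ord_max ^+ 2 = 1].

End SmoothSubsets.

(* M is a submanifold of U carrying the symplectic form omega, where
   omega x v w is meaningful for x in M and v, w tangent to M at x. *)
Section Symplectic.
Variables (R : realType) (U : normedModType R).
Variables (M : set U) (omega : U -> U -> U -> R).

Definition lagrangian (L : set U) : Prop :=
  [/\ L `<=` M,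
      (exists d : nat, submanifold d L /\ submanifold (2 * d)%N M) &
      forall x v w, L x -> tangent L x v -> tangent L x w -> omega x v w = 0].

(* v is the value at x of the Hamiltonian vector field X_f, with the convention
   omega (X_f, -) = df; here df (c'(0)) is computed as (f \o c)'(0). *)
Definition hamiltonian_vector (f : U -> R) (x v : U) : Prop :=
  tangent M x v /\
  forall (c : R^o -> U) (w : U),
    smooth_curve M x c -> is_derive (0 : R^o) 1 c w ->
    is_derive (0 : R^o) (1 : R^o) ((fun s => f (c s)) : R^o -> R^o)
      (omega x v w).

(* On M, phi is the time-one map of the flow psi of the smooth time-dependent
   Hamiltonian H. No support condition is imposed on H, as befits a compact M;
   taking the time in R rather than in [0, 1] then defines the same group. *)
Definition hamiltonian_diffeo (phi : U -> U) : Prop :=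
  exists (H : (R^o * U)%type -> R^o) (psi : (R^o * U)%type -> U),
    [/\ smooth_on (setT `*` M) H,
        smooth_on (setT `*` M) psi,
        (forall x, M x -> psi (0, x) = x /\ psi (1, x) = phi x) &
        forall (s : R^o) x, M x ->
          M (psi (s, x)) /\
          exists v, hamiltonian_vector (fun y => H (s, y)) (psi (s, x)) v /\
            is_derive s (1 : R^o) (fun r : R^o => psi (r, x)) v].

Definition displaceable (Y : set U) : Prop :=
  exists phi, hamiltonian_diffeo phi /\ (phi @` Y) `&` closure Y = set0.

End Symplectic.

(* Complex p x p matrices as a real normed space: (real part, imaginary part).
   R[i] itself only carries a complex normed structure in the library. *)
Notation cmx R p := ('M[R]_p * 'M[R]_p)%type.

Section GelfandCetlin.
Variables (R : realType) (p : nat).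
Local Notation cmx := (cmx R p).

Definition toC (x : cmx) : 'M[R[i]]_p :=
  \matrix_(a, b) Complex (x.1 a b) (x.2 a b).

(* The roots of the characteristic polynomial with multiplicity, in
   nonincreasing order. Only used for Hermitian A, whose eigenvalues are real. *)
Definition eigenvalues (m : nat) (A : 'M[R[i]]_m) : seq R :=
  sort >=%R
    [seq complex.Re z | z <- sval (closed_field_poly_normal (char_poly A))].

Definition coadjoint_orbit (lambda : p.-tuple R) : set cmx :=
  [set x | toC x \is hermsymmx /\ perm_eq (eigenvalues (toC x)) lambda].

Definition skew_hermitian (X : 'M[R[i]]_p) : Prop :=
  X \is hermitianmx _ true Num.conj.

Definition bracket (X Y : 'M[R[i]]_p) : 'M[R[i]]_p := X *m Y - Y *m X.

(* A skew-Hermitian X with [X, h] = v; one exists when v is tangent at h to the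
   orbit of the Hermitian matrix h. *)
Definition skew_lift (h v : cmx) : 'M[R[i]]_p :=
  xget 0 [set X | skew_hermitian X /\ bracket X (toC h) = toC v].

Definition kks (h v w : cmx) : R :=
  complex.Re (\tr ((Complex 0 1 : R[i]) *:
    (toC h *m bracket (skew_lift h v) (skew_lift h w)))).

Definition leading (m : nat) (hm : (m <= p)%N) (x : 'M[R[i]]_p) : 'M[R[i]]_m :=
  mxsub (widen_ord hm) (widen_ord hm) x.

(* Indices are shifted by one: the pair (a, b) stands for i = a + 1, j = b + 1,
   so that i + j <= p + 1 reads a + b < p, and i + j - 1 is (a + b).+1. *)
Definition gc_index : Type := {ij : 'I_p * 'I_p | (ij.1 + ij.2 < p)%N}.

Definition gc_fun (k : gc_index) (x : cmx) : R :=
  nth 0 (eigenvalues (leading (svalP k) (toC x))) (sval k).1.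

Definition nonconstant_on (S : set cmx) (f : cmx -> R) : Prop :=
  ~ exists c, forall x, S x -> f x = c.

Variable lambda : p.-tuple R.

Definition gc_nc_index : Type :=
  {k : gc_index | nonconstant_on (coadjoint_orbit lambda) (gc_fun k)}.

Definition gc_system (x : cmx) : gc_nc_index -> R :=
  fun k => gc_fun (sval k) x.

Definition gc_polytope : set (gc_nc_index -> R) :=
  gc_system @` coadjoint_orbit lambda.

Definition gc_fiber (u : gc_nc_index -> R) : set cmx :=
  coadjoint_orbit lambda `&` [set x | gc_system x = u].

End GelfandCetlin.

Definition gr2_spectrum (R : realType) (p : nat) (t : R) : p.-tuple R :=
  [tuple if (k < 2)%N then t else 0 | k < p].

(* kks does not depend on the choice made in skew_lift. *)
Lemma kksE (R : realType) (p : nat) (h v w : cmx R p) (X Y : 'M[R[i]]_p) :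
  skew_hermitian X -> bracket X (toC h) = toC v ->
  skew_hermitian Y -> bracket Y (toC h) = toC w ->
  kks h v w = complex.Re (\tr ((Complex 0 1 : R[i]) *: (toC h *m bracket X Y))).
Proof.
move=> sX Xv sY Yw; rewrite /kks.
have trl (A B C : 'M[R[i]]_p) :
    \tr (C *m bracket A B) = - \tr (bracket A C *m B).
  rewrite /bracket mulmxBr mulmxBl !raddfB /= !mulmxA opprK [RHS]addrC.
  by rewrite (mxtrace_mulC (C *m B)) mulmxA.
have trr (A B C : 'M[R[i]]_p) :
    \tr (C *m bracket A B) = \tr (bracket B C *m A).
  rewrite /bracket mulmxBr mulmxBl !raddfB /= !mulmxA.
  by rewrite (mxtrace_mulC (C *m A)) mulmxA.
have [_ liftv] : skew_hermitian (skew_lift h v) /\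
    bracket (skew_lift h v) (toC h) = toC v.
  by apply: (xgetPex 0 (P := [set X | skew_hermitian X /\ _])); exists X.
have [_ liftw] : skew_hermitian (skew_lift h w) /\
    bracket (skew_lift h w) (toC h) = toC w.
  by apply: (xgetPex 0 (P := [set X | skew_hermitian X /\ _])); exists Y.
by rewrite !mxtraceZ trl liftv -Xv -trl trr liftw -Yw -trr.
Qed.

(* Main.v *)
(* Write a point of the orbit as x = V V^*, where V is a p x 2 matrix with
   V^* V = t, and let v_i be the rows of V. The eigenvalues of the leading minors
   of x are those of the partial sums M_k of the v_i^* v_i (apart from zeros), so
   a fiber prescribes the trace and the trace of the square of every M_k:
   up to a unitary of C^2, V is a polygon with prescribed edge lengths and
   prescribed diagonals from its first vertex.

   If no M_k with 0 < k < p is scalar, every M_k has two distinct eigenvalues, and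
   rotating the rest of the polygon about its k-th diagonal (bending) turns one
   frame V into all points of the fiber, which is thus a torus.

   Otherwise let Z be the set of all k such that M_k is scalar. Permutation
   matrices act on the orbit by Hamiltonian diffeomorphisms. If k < l belong to Z
   and l - k does not, reversing the first l coordinates displaces the fiber: on
   the intersection the first l rows and, among them, the last k rows have scalar
   sums, hence so do the first l - k rows. If no such k and l exist then p is a
   multiple of the least positive element of Z, which is less than p and thus
   equal to 1; then M_1 has rank at most 1, so v_1 = 0, and exchanging the first
   coordinate with that of a nonzero row displaces the fiber. *)
Require Import Defs.
From HB Require Import structures.
From mathcomp Require Import all_boot all_order all_algebra.
From mathcomp Require Import fingroup perm sesquilinear spectral.
From mathcomp Require Import complex.
From mathcomp Require Import all_classical all_reals all_analysis.
From mathcomp Require Import ring lra zify.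
Set Implicit Arguments.
Unset Strict Implicit.
Unset Printing Implicit Defensive.
Import Order.TTheory GRing.Theory Num.Theory numFieldNormedType.Exports.
Local Open Scope classical_set_scope.
Local Open Scope ring_scope.

(** * Smooth maps *)

Section Smooth.
Variable R : realType.

Definition smooth (U V : normedModType R) (f : U -> V) : Prop :=
  forall k, class_C k setT f.

Lemma smooth_on_smooth (U V : normedModType R) (S : set U) (f : U -> V) :
  smooth f -> smooth_on S f.
Proof. by move=> sf x _; exists setT, f; split => //; exact: openT. Qed.

Lemma class_C_eq (U V : normedModType R) k (g f : U -> V) :
  f =1 g -> class_C k setT g -> class_C k setT f.
Proof. by move=> /funext ->. Qed.

Lemma class_C_lower (U V : normedModType R) k (f : U -> V) :
  class_C k.+1 setT f -> class_C k setT f.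
Proof.
elim: k f => [|k IHk] f /= [df Df]; first by move=> x _; exact/differentiable_continuous/df.
by split=> // v; apply: IHk; exact: Df.
Qed.

Lemma class_C_cst (U V : normedModType R) k (a : V) :
  class_C k setT (fun _ : U => a).
Proof.
elim: k a => [|k IHk] a /=; first by move=> x _; exact: cst_continuous.
split=> [x _|v]; first exact: differentiable_cst.
by apply: class_C_eq (IHk 0) => x; exact: derive_cst.
Qed.

Lemma class_CD (U V : normedModType R) k (f g : U -> V) :
  class_C k setT f -> class_C k setT g -> class_C k setT (fun x => f x + g x).
Proof.
elim: k f g => [|k IHk] f g /= cf cg.
  by move=> x _; apply: continuousD; [exact: cf|exact: cg].
have [[df Df] [dg Dg]] := (cf, cg); split=> [x _|v].
  by apply: differentiableD; [exact: df|exact: dg].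
apply: (class_C_eq (g := fun x => 'D_v f x + 'D_v g x)); last exact: IHk.
by move=> x; apply: deriveD; apply: diff_derivable; [exact: df|exact: dg].
Qed.

Lemma class_CM (U : normedModType R) k (f g : U -> R^o) :
  class_C k setT f -> class_C k setT g ->
  class_C k setT (fun x => f x * g x : R^o).
Proof.
elim: k f g => [|k IHk] f g cf cg.
  by move=> x _; apply: continuousM; [exact: cf|exact: cg].
have [[df Df] [dg Dg]] := (cf, cg); split=> [x _|v].
  by apply: (@differentiableM R U f g); [exact: df|exact: dg].
apply: (class_C_eq
    (g := fun x => (f x * 'D_v g x : R^o) + (g x * 'D_v f x : R^o))).
  move=> x; apply: (@deriveM R U f g); apply: diff_derivable;
    [exact: df|exact: dg].
by apply: class_CD; apply: IHk; [exact: (class_C_lower cf)|exact: Dg|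
  exact: (class_C_lower cg)|exact: Df].
Qed.

Lemma class_CZ (U V : normedModType R) k (f : U -> R^o) (e : V) :
  class_C k setT f -> class_C k setT (fun x => f x *: e).
Proof.
elim: k f => [|k IHk] f cf.
  by move=> x _; apply: cvgZr_tmp; exact: cf.
have [df Df] := cf; split=> [x _|v].
  by apply: (@differentiableZl R U V f e); exact: df.
apply: (class_C_eq (g := fun x => 'D_v f x *: e)); last exact: (IHk _ (Df v)).
move=> x; have dfx := df x I.
rewrite deriveE; last exact: differentiableZl.
by rewrite (@diffZl R U V f e) // [in RHS]deriveE.
Qed.

(** Serves for linear maps: the first derivative does not depend on the point, so all further ones
    vanish. *)
Lemma class_C_derive_cst (U V : normedModType R) k (f : U -> V) (l : U -> V) :
  (forall x, differentiable f x) -> (forall v x, 'D_v f x = l v) ->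
  class_C k setT f.
Proof.
move=> df Df; case: k => [|k] /=; first by move=> x _; exact/differentiable_continuous.
split=> // v; apply: (class_C_eq (g := fun=> l v)); last exact: class_C_cst.
by move=> x; exact: Df.
Qed.

Lemma smooth_eq (U V : normedModType R) (g f : U -> V) :
  f =1 g -> smooth g -> smooth f.
Proof. by move=> /funext ->. Qed.

Lemma smooth_linear (U V : normedModType R) (f : {linear U -> V}) :
  continuous f -> smooth f.
Proof.
move=> cf k; apply: (@class_C_derive_cst _ _ _ _ f) => [x|v x].
  exact: linear_differentiable.
by rewrite deriveE ?diff_lin //; exact: linear_differentiable.
Qed.

Lemma smooth_cst (U V : normedModType R) (a : V) : smooth (fun _ : U => a).
Proof. by move=> k; exact: class_C_cst. Qed.

Lemma smoothD (U V : normedModType R) (f g : U -> V) :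
  smooth f -> smooth g -> smooth (fun x => f x + g x).
Proof. by move=> sf sg k; exact: class_CD. Qed.

Lemma smooth_sum (U V : normedModType R) (I : Type) (r : seq I) (P : pred I)
    (f : I -> U -> V) :
  (forall i, P i -> smooth (f i)) -> smooth (fun x => \sum_(i <- r | P i) f i x).
Proof.
move=> sf; elim: r => [|i r IHr].
  by apply: (smooth_eq (g := fun=> 0)); [move=> x; exact: big_nil|exact: smooth_cst].
apply: (smooth_eq
    (g := fun x => (if P i then f i x else 0) + \sum_(i <- r | P i) f i x)).
  by move=> x; rewrite [LHS]big_cons; case: ifP => //; rewrite add0r.
by apply: smoothD => //; case: (P i) (sf i) => [/(_ isT)//|_]; exact: smooth_cst.
Qed.

Lemma smoothM (U : normedModType R) (f g : U -> R^o) :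
  smooth f -> smooth g -> smooth (fun x => f x * g x : R^o).
Proof. by move=> sf sg k; exact: class_CM. Qed.

Lemma smoothN (U : normedModType R) (f : U -> R^o) :
  smooth f -> smooth (fun x => - f x : R^o).
Proof.
move=> sf; apply: (smooth_eq (g := fun x => (-1 : R^o) * f x : R^o)).
  by move=> x; rewrite mulN1r.
by apply: smoothM => //; exact: smooth_cst.
Qed.

Lemma smoothZ (U V : normedModType R) (f : U -> R^o) (e : V) :
  smooth f -> smooth (fun x => f x *: e).
Proof. by move=> sf k; exact: class_CZ. Qed.

Lemma smooth_continuous (U V : normedModType R) (f : U -> V) :
  smooth f -> continuous f.
Proof. by move=> /(_ 0%N) cf x; exact: cf. Qed.

(** Differentiation exchanges the two functions up to sign and the constant factor [L v], so both
    are treated in one induction on the class. *)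
Lemma smooth_cos_sin (U : normedModType R) (L : {linear U -> R^o}) :
  continuous L ->
  smooth (fun x => cos (L x) : R^o) /\ smooth (fun x => sin (L x) : R^o).
Proof.
move=> cL; have dL x : differentiable L x by exact: linear_differentiable.
have D (f : R -> R) df v x : is_derive (L x : R) (1 : R) f df ->
    differentiable (f \o L : U -> R^o) x /\ 'D_v (f \o L : U -> R^o) x = df * L v.
  move=> fx; have dfx : differentiable (f : R^o -> R^o) (L x).
    by apply/derivable1_diffP; exact: ex_derive.
  split; first exact: differentiable_comp.
  rewrite deriveE; last exact: differentiable_comp.
  rewrite diff_comp //= diff_lin // -[L v in LHS]mulr1 -[_ * 1]/(L v *: (1 : R^o)).
  by rewrite linearZ /= -deriveE // mulrC (@derive_val _ _ _ _ _ _ _ fx).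
suff cs k : class_C k setT (fun x => cos (L x) : R^o) /\
            class_C k setT (fun x => sin (L x) : R^o).
  by split=> k; have [] := cs k.
elim: k => [|k [IHc IHs]]; split=> /=.
- by move=> x _; apply: continuous_comp; [exact: cL|exact: continuous_cos].
- by move=> x _; apply: continuous_comp; [exact: cL|exact: continuous_sin].
- split=> [x _|v]; first by case: (D cos _ 0 x (is_derive_cos _)).
  apply: (class_C_eq (g := fun x => (sin (L x) : R^o) * (- L v))); last first.
    by apply: class_CM => //; exact: class_C_cst.
  by move=> x; case: (D cos _ v x (is_derive_cos _)) => _ ->; rewrite mulrN mulNr.
- split=> [x _|v]; first by case: (D sin _ 0 x (is_derive_sin _)).
  apply: (class_C_eq (g := fun x => (cos (L x) : R^o) * L v)); last first.
    by apply: class_CM => //; exact: class_C_cst.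
  by move=> x; case: (D sin _ v x (is_derive_sin _)) => _ ->.
Qed.

Definition mxcoord m n (i : 'I_m) (j : 'I_n) (z : 'M[R]_(m, n)) : R^o := z i j.

Lemma mxcoord_is_linear m n (i : 'I_m) (j : 'I_n) : linear (mxcoord i j).
Proof. by move=> a u v; rewrite /mxcoord !mxE. Qed.

HB.instance Definition _ m n (i : 'I_m) (j : 'I_n) :=
  GRing.isLinear.Build R 'M[R]_(m, n) R^o _ (mxcoord i j) (mxcoord_is_linear i j).

Lemma smooth_mxcoord (U : normedModType R) m n (L : {linear U -> 'M[R]_(m, n)}) i j :
  continuous L -> smooth (fun x => L x i j : R^o).
Proof.
move=> cL; apply: (@smooth_linear _ _ (mxcoord i j \o L)) => x.
apply: continuous_comp; [exact: cL|exact: coord_continuous].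
Qed.

Lemma smooth_sum_delta (U V : normedModType R) m n (L : {linear 'M[R]_(m, n) -> V})
    (F : U -> 'M[R]_(m, n)) :
  (forall i j, smooth (fun x => F x i j : R^o)) -> smooth (fun x => L (F x)).
Proof.
move=> sF; apply: (smooth_eq (g := fun x =>
    \sum_i \sum_j (F x i j *: L (delta_mx i j)))).
  move=> x; rewrite [in LHS](matrix_sum_delta (F x)) linear_sum; apply: eq_bigr => i _.
  by rewrite linear_sum; apply: eq_bigr => j _; rewrite linearZ.
by do 2!(apply: smooth_sum => ? _); exact: smoothZ.
Qed.

Lemma smooth_mx (U : normedModType R) m n (F : U -> 'M[R]_(m, n)) :
  (forall i j, smooth (fun x => F x i j : R^o)) -> smooth F.
Proof. exact: (@smooth_sum_delta U _ m n idfun F). Qed.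

Lemma smooth_pairmx (U : normedModType R) m n m' n' (F : U -> 'M[R]_(m, n))
    (G : U -> 'M[R]_(m', n')) :
  (forall i j, smooth (fun x => F x i j : R^o)) ->
  (forall i j, smooth (fun x => G x i j : R^o)) ->
  smooth (fun x => (F x, G x)).
Proof.
move=> sF sG; pose W := ('M[R]_(m, n) * 'M[R]_(m', n'))%type.
pose L1 (A : 'M[R]_(m, n)) : W := (A, 0).
pose L2 (A : 'M[R]_(m', n')) : W := (0, A).
have l1 : linear L1 by move=> a u v; apply: injective_projections; rewrite /= ?scaler0 ?addr0.
have l2 : linear L2 by move=> a u v; apply: injective_projections; rewrite /= ?scaler0 ?addr0.
pose L1' := HB.pack_for {linear 'M[R]_(m, n) -> W} L1 (GRing.isLinear.Build _ _ _ _ L1 l1).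
pose L2' := HB.pack_for {linear 'M[R]_(m', n') -> W} L2 (GRing.isLinear.Build _ _ _ _ L2 l2).
apply: (smooth_eq (g := fun x => L1' (F x) + L2' (G x))).
  by move=> x; apply: injective_projections; rewrite /= ?addr0 ?add0r.
by apply: smoothD; [exact: (smooth_sum_delta L1')|exact: (smooth_sum_delta L2')].
Qed.
End Smooth.

(** * Real smoothness of complex-valued maps *)

Section ComplexSmooth.
Local Open Scope sesquilinear_scope.
Variables (R : realType) (U : normedModType R).
Local Notation C := R[i].

(** Read on the two real components, so that conjugation, which is not complex differentiable,
    preserves smoothness. *)
Definition smoothC (F : U -> C) : Prop :=
  smooth (fun x => complex.Re (F x) : R^o) /\ smooth (fun x => complex.Im (F x) : R^o).

Definition smoothCmx m n (F : U -> 'M[C]_(m, n)) : Prop :=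
  forall i j, smoothC (fun x => F x i j).

Lemma eq_smoothC (G F : U -> C) : F =1 G -> smoothC G -> smoothC F.
Proof. by move=> /funext ->. Qed.

Lemma smoothC_cst (a : C) : smoothC (fun=> a).
Proof. by split; exact: smooth_cst. Qed.

Lemma smoothCD (F G : U -> C) : smoothC F -> smoothC G -> smoothC (fun x => F x + G x).
Proof.
move=> [F1 F2] [G1 G2]; split.
  by apply: smooth_eq (smoothD F1 G1) => x; case: (F x) (G x) => [? ?] [].
by apply: smooth_eq (smoothD F2 G2) => x; case: (F x) (G x) => [? ?] [].
Qed.

Lemma smoothCM (F G : U -> C) : smoothC F -> smoothC G -> smoothC (fun x => F x * G x).
Proof.
move=> [F1 F2] [G1 G2]; split.
  apply: smooth_eq (smoothD (smoothM F1 G1) (smoothN (smoothM F2 G2))) => x.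
  by case: (F x) (G x) => [? ?] [].
apply: smooth_eq (smoothD (smoothM F1 G2) (smoothM F2 G1)) => x.
by case: (F x) (G x) => [? ?] [].
Qed.

Lemma smoothC_conj (F : U -> C) : smoothC F -> smoothC (fun x => (F x)^*).
Proof.
move=> [F1 F2]; split; first by apply: smooth_eq F1 => x; case: (F x).
by apply: smooth_eq (smoothN F2) => x; case: (F x).
Qed.

Lemma smoothC_sum (I : Type) (r : seq I) (F : I -> U -> C) :
  (forall i, smoothC (F i)) -> smoothC (fun x => \sum_(i <- r) F i x).
Proof.
move=> sF; elim: r => [|i r IHr].
  by apply: eq_smoothC (smoothC_cst 0) => x; rewrite big_nil.
by apply: eq_smoothC (smoothCD (sF i) IHr) => x; rewrite big_cons.
Qed.

Lemma smoothCmx_cst m n (A : 'M[C]_(m, n)) : smoothCmx (fun=> A).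
Proof. by move=> i j; exact: smoothC_cst. Qed.

Lemma smoothCmxM m n k (F : U -> 'M[C]_(m, n)) (G : U -> 'M[C]_(n, k)) :
  smoothCmx F -> smoothCmx G -> smoothCmx (fun x => F x *m G x).
Proof.
move=> sF sG i j; apply: (eq_smoothC (G := fun x => \sum_l F x i l * G x l j)).
  by move=> x; rewrite mxE.
by apply: smoothC_sum => l; exact: smoothCM.
Qed.

Lemma smoothCmx_trC m n (F : U -> 'M[C]_(m, n)) :
  smoothCmx F -> smoothCmx (fun x => (F x)^t*).
Proof.
move=> sF i j; apply: eq_smoothC (smoothC_conj (sF j i)) => x.
by rewrite !mxE.
Qed.

Lemma smoothCmx_row m n (i : 'I_m) (F : U -> 'M[C]_(m, n)) :
  smoothCmx F -> smoothCmx (fun x => row i (F x)).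
Proof. by move=> sF k j; apply: eq_smoothC (sF i j) => x; rewrite mxE. Qed.

Lemma smoothCmx_diag n (F : U -> 'rV[C]_n) :
  smoothCmx F -> smoothCmx (fun x => diag_mx (F x)).
Proof.
move=> sF i j; have [ij|ij] := boolP (i == j).
  by apply: eq_smoothC (sF 0 i) => x; rewrite mxE ij mulr1n.
by apply: eq_smoothC (smoothC_cst 0) => x; rewrite mxE (negbTE ij) mulr0n.
Qed.

End ComplexSmooth.

(** * Orbits and fibers in terms of frames *)

Section LinearAlgebra.
Local Open Scope sesquilinear_scope.

(* Both sides are determinants of products of [block_mx 'X%:M A B 1%:M] with a
   block triangular matrix. *)
Lemma char_poly_mulC (F : fieldType) m n (A : 'M[F]_(m, n)) (B : 'M[F]_(n, m)) :
  char_poly (A *m B) * 'X^n = 'X^m * char_poly (B *m A).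
Proof.
pose A' := map_mx polyC A; pose B' := map_mx polyC B.
pose M := block_mx ('X%:M : 'M[{poly F}]_m) A' B' 1%:M.
have dM1 : \det M = char_poly (A *m B).
  have -> : char_poly (A *m B) = \det (M *m block_mx 1%:M 0 (- B') 1%:M).
    rewrite /M mulmx_block !mulmx1 !mul1mx !mulmx0 !add0r mulmxN subrr det_ublock.
    by rewrite det1 mulr1 /char_poly /char_poly_mx map_mxM.
  by rewrite det_mulmx det_lblock !det1 !mulr1.
have dM2 : 'X^n * \det M = 'X^m * char_poly (B *m A).
  have -> : 'X^n * \det M =
      \det (block_mx (1%:M : 'M[{poly F}]_m) 0 (- B') 'X%:M *m M).
    by rewrite det_mulmx det_lblock det1 mul1r det_scalar.
  rewrite /M mulmx_block !mulmx1 !mul1mx !mul0mx !addr0 mulNmx.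
  rewrite scalar_mxC addNr det_ublock det_scalar.
  by rewrite /char_poly /char_poly_mx map_mxM mulNmx addrC.
by rewrite -dM2 dM1 mulrC.
Qed.

Lemma det_mx2 (F : comNzRingType) (M : 'M[F]_2) :
  \det M = M 0 0 * M 1 1 - M 0 1 * M 1 0.
Proof.
rewrite (expand_det_row _ 0) !big_ord_recl big_ord0 addr0 /cofactor !det_mx11.
rewrite !mxE /= expr0 expr1 mul1r mulN1r mulrN.
have -> : lift 0 0 = 1 :> 'I_2 by exact/val_inj.
by have -> : lift 1 0 = 0 :> 'I_2 by exact/val_inj.
Qed.

Lemma mxtrace2 (F : nmodType) (M : 'M[F]_2) : \tr M = M 0 0 + M 1 1.
Proof.
by rewrite /mxtrace !big_ord_recl big_ord0 addr0; congr (_ + M _ _); apply/val_inj.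
Qed.

Lemma mulmx2E (F : pzSemiRingType) m n (A : 'M[F]_(m, 2)) (B : 'M[F]_(2, n)) i j :
  (A *m B) i j = A i 0 * B 0 j + A i 1 * B 1 j.
Proof.
rewrite mxE !big_ord_recl big_ord0 addr0.
by congr (_ + A _ _ * B _ _); apply/val_inj.
Qed.

(** In size 2 the coefficients are the trace and the determinant, and the latter is ((tr M)^2 - tr
    M^2) / 2. *)
Lemma char_poly2_eq (F : numFieldType) (M N : 'M[F]_2) :
  \tr M = \tr N -> \tr (M *m M) = \tr (N *m N) -> char_poly M = char_poly N.
Proof.
move=> tMN tMN2; apply/polyP => i.
have dMN : \det M = \det N.
  have E (K : 'M[F]_2) : \det K = (\tr K ^+ 2 - \tr (K *m K)) / 2.
    by rewrite det_mx2 !mxtrace2 !mulmx2E; field.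
  by rewrite !E tMN tMN2.
case: i => [|[|[|i]]].
- by rewrite !char_poly_det dMN.
- have := char_poly_trace M isT; have := char_poly_trace N isT.
  by rewrite /= => -> ->; rewrite tMN.
- have /monicP := char_poly_monic M; have /monicP := char_poly_monic N.
  by rewrite /lead_coef !size_char_poly /= => -> ->.
- by rewrite !nth_default // size_char_poly.
Qed.

Variable R : realType.
Local Notation C := R[i].

Lemma trC_mul m n k (A : 'M[C]_(m, n)) (B : 'M[C]_(n, k)) :
  (A *m B)^t* = B^t* *m A^t*.
Proof. by rewrite trmx_mul map_mxM. Qed.

Lemma hermsymmxP n (A : 'M[C]_n) : reflect (A^t* = A) (A \is hermsymmx).
Proof.
by rewrite is_hermitianmxE expr0 scale1r eq_sym; exact: eqP.
Qed.

Lemma unitarymxPl n (M : 'M[C]_n) : M \is unitarymx -> M^t* *m M = 1%:M.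
Proof. by move=> /unitarymxP/mulmx1C. Qed.

Lemma eigenvalues_perm n (A : 'M[C]_n) (s : seq C) :
  char_poly A = \prod_(z <- s) ('X - z%:P) ->
  perm_eq (eigenvalues A) [seq complex.Re z | z <- s].
Proof.
move=> cA; rewrite /eigenvalues perm_sort; apply: perm_map.
case: closed_field_poly_normal => r /= rE; apply: prod_XsubC_eq.
by rewrite -cA rE (monicP (char_poly_monic A)) scale1r.
Qed.

Lemma spectral_decomposition n (A : 'M[C]_n) : A \is hermsymmx ->
  [/\ A = (spectralmx A)^t* *m diag_mx (spectral_diag A) *m spectralmx A,
      (forall i, (complex.Re (spectral_diag A 0 i))%:C%C = spectral_diag A 0 i) &
      perm_eq (eigenvalues A)
        [seq complex.Re (spectral_diag A 0 i) | i <- enum 'I_n]].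
Proof.
move=> hA; have uA := spectral_unitarymx A.
have AE := orthomx_spectralP (hermitian_normalmx hA).
split.
- by rewrite {1}AE invmx_unitary.
- by move=> i; apply: RRe_real; apply/mxOverP; exact: hermitian_spectral_diag_real.
- rewrite (map_comp (@complex.Re R) (spectral_diag A 0)).
  apply: eigenvalues_perm; rewrite big_map big_enum.
  (* Swapping the factors turns P^-1 D P into D; the common power of 'X is then cancelled. *)
  have := char_poly_mulC (invmx (spectralmx A) *m diag_mx (spectral_diag A)) (spectralmx A).
  rewrite -AE mulmxA mulmxV ?spectral_unit // mul1mx mulrC.
  move=> /(mulfI (expf_neq0 _ (negbT (polyX_eq0 _)))) ->.
  rewrite char_poly_trig ?diag_mx_is_trig //.
  by apply: eq_bigr => i _; rewrite !mxE eqxx mulr1n.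
Qed.

Lemma hermitian_eigenvalues_sum n (A : 'M[C]_n) : A \is hermsymmx ->
  (\sum_(e <- eigenvalues A) e)%:C%C = \tr A /\
  (\sum_(e <- eigenvalues A) e ^+ 2)%:C%C = \tr (A *m A).
Proof.
move=> hA; have [AE Dr pA] := spectral_decomposition hA.
have uA := spectral_unitarymx A.
have sumE (f : R -> R) : \sum_(e <- eigenvalues A) f e =
    \sum_i f (complex.Re (spectral_diag A 0 i)).
  by rewrite (perm_big _ pA) big_map big_enum.
rewrite (sumE id) (sumE (fun e => e ^+ 2)) !rmorph_sum /=.
move: (spectralmx A) (spectral_diag A) AE Dr uA {pA sumE} => P D AE Dr uA.
split.
  rewrite AE mxtrace_mulC mulmxA (unitarymxP uA) mul1mx; apply: eq_bigr => i _.
  by rewrite !mxE eqxx mulr1n Dr.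
have -> : A *m A = P^t* *m (diag_mx D *m diag_mx D *m P).
  by rewrite {1 2}AE !mulmxA mulmxtVK.
rewrite mxtrace_mulC mulmxtVK // mulmx_diag; apply: eq_bigr => i _.
by rewrite !mxE eqxx mulr1n rmorphXn /= Dr expr2.
Qed.

Lemma size_eigenvalues n (A : 'M[C]_n) : size (eigenvalues A) = n.
Proof.
rewrite /eigenvalues size_sort size_map; case: closed_field_poly_normal => r /= rE.
have /eqP := size_char_poly A; rewrite rE (monicP (char_poly_monic A)) scale1r.
by rewrite size_prod_XsubC => /eqP [].
Qed.

End LinearAlgebra.

(** * Frames V with x = V V^*, and the Gelfand-Cetlin values in terms of their partial sums *)

Section Grassmannian.
Local Open Scope sesquilinear_scope.
Variables (R : realType) (p : nat).
Local Notation C := R[i].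

Definition ofC (A : 'M[C]_p) : cmx R p :=
  (map_mx (@complex.Re R) A, map_mx (@complex.Im R) A).

Lemma toCK : cancel (@toC R p) ofC.
Proof. by case=> a b; congr pair; apply/matrixP => i j; rewrite !mxE. Qed.

Lemma ofCK : cancel ofC (@toC R p).
Proof. by move=> A; apply/matrixP => i j; rewrite !mxE; case: (A i j). Qed.

(** The partial sum M_k of the overview; rows are counted from 0, so [gram i.+1 V] adds row [i] to
    [gram i V]. *)
Definition gram (k : nat) (V : 'M[C]_(p, 2)) : 'M[C]_2 :=
  \sum_(i < p | (i < k)%N) (row i V)^t* *m row i V.

Lemma gramE k V a b :
  gram k V a b = \sum_(i < p | (i < k)%N) (V i a)^* * V i b.
Proof.
rewrite /gram summxE; apply: eq_bigr => i _.
by rewrite mxE big_ord1 !mxE.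
Qed.

Lemma gram_herm k V : (gram k V)^t* = gram k V.
Proof.
apply/matrixP => a b; rewrite !mxE !gramE rmorph_sum; apply: eq_bigr => i _.
by rewrite rmorphM /= conjCK mulrC.
Qed.

Lemma gram_full V : gram p V = V^t* *m V.
Proof.
apply/matrixP => a b; rewrite gramE mxE; apply: eq_big => [i|i _]; first exact: ltn_ord.
by rewrite !mxE.
Qed.

Lemma gramS (i : 'I_p) V : gram i.+1 V = gram i V + (row i V)^t* *m row i V.
Proof.
rewrite /gram (bigD1 i) /= ?ltnSn // addrC; congr (_ + _).
apply: eq_bigl => j; rewrite ltnS leq_eqVlt -(inj_eq val_inj) /=.
by case: ltngtP.
Qed.

Lemma leading_gram m (hm : (m <= p)%N) (V : 'M[C]_(p, 2)) :
  let W := rowsub (widen_ord hm) V in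
  leading hm (V *m V^t*) = W *m W^t* /\ W^t* *m W = gram m V.
Proof.
split; apply/matrixP => a b.
  by rewrite !mxE; apply: eq_bigr => j _; rewrite !mxE.
rewrite gramE (big_ord_narrow hm) mxE.
by apply: eq_bigr => j _; rewrite !mxE.
Qed.

(** The minor and the partial sum are U U^* and U^* U for the truncated frame U, so their
    characteristic polynomials determine each other; the partial sum has size 2 and is controlled by
    two traces. *)
Lemma leading_eigenvaluesP m (hm : (m <= p)%N) (V W : 'M[C]_(p, 2)) :
  eigenvalues (leading hm (V *m V^t*)) = eigenvalues (leading hm (W *m W^t*)) <->
  \tr (gram m V) = \tr (gram m W) /\
  \tr (gram m V *m gram m V) = \tr (gram m W *m gram m W).
Proof.
have [VE VG] := leading_gram hm V; have [WE WG] := leading_gram hm W.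
move: (rowsub _ V) (rowsub _ W) VE VG WE WG => V' W' VE VG WE WG.
have herm (U : 'M[C]_(m, 2)) : U *m U^t* \is hermsymmx.
  by apply/hermsymmxP; rewrite trC_mul trmxCK.
have trG (U : 'M[C]_(m, 2)) : \tr (U *m U^t*) = \tr (U^t* *m U) /\
    \tr (U *m U^t* *m (U *m U^t*)) = \tr (U^t* *m U *m (U^t* *m U)).
  by split; rewrite mxtrace_mulC // -!mulmxA [in RHS]mxtrace_mulC !mulmxA.
rewrite VE WE -VG -WG; split=> [eVW|[t1 t2]].
  have [s1 s2] := hermitian_eigenvalues_sum (herm V').
  have [s3 s4] := hermitian_eigenvalues_sum (herm W').
  have [<- <-] := trG V'; have [<- <-] := trG W'.
  by split; [rewrite -[LHS]s1 -[RHS]s3 eVW|rewrite -[LHS]s2 -[RHS]s4 eVW].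
have := char_poly_mulC V' (V'^t*); rewrite (char_poly2_eq t1 t2).
rewrite -char_poly_mulC => /(mulIf (expf_neq0 _ (negbT (polyX_eq0 _)))) cVW.
by rewrite /eigenvalues cVW.
Qed.

Variable t : R.
Local Notation lambda := (gr2_spectrum p t).

(** The columns of V are sqrt t times orthonormal eigenvectors for the eigenvalue t. *)
Lemma orbit_frame (x : cmx R p) : (1 < p)%N -> 0 < t ->
  coadjoint_orbit lambda x ->
  exists V : 'M[C]_(p, 2), toC x = V *m V^t* /\ V^t* *m V = (t%:C%C)%:M.
Proof.
move=> hp t0 [/spectral_decomposition [AE Dr pA] eA].
have uA := spectral_unitarymx (toC x).
move: (spectralmx _) (spectral_diag _) AE Dr pA uA => P D AE Dr pA uA.
(* The spectral diagonal is [lambda] up to a permutation [s]; below, [w] picks the two positions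
   where it equals t. *)
have /tuple_permP[s sE] : perm_eq [seq complex.Re (D 0 i) | i <- enum 'I_p] lambda.
  by rewrite -(permPl pA).
have DE i : D 0 i = (if (s i < 2)%N then t else 0)%:C%C.
  rewrite -Dr; congr (_%:C)%C.
  have := congr1 (nth 0 ^~ i) sE.
  rewrite (nth_map i) ?size_enum_ord // nth_ord_enum => ->.
  by rewrite -tnth_nth !tnth_mktuple.
have tt : (Num.sqrt t)%:C%C * (Num.sqrt t)%:C%C = t%:C%C :> C.
  by rewrite -rmorphM /= -expr2 sqr_sqrtr // ltW.
have cr (r : R) : (r%:C%C : C)^* = r%:C%C := conjc_real r.
pose w (j : 'I_2) := (s^-1%g (widen_ord hp j)).
exists (\matrix_(a, j) ((Num.sqrt t)%:C%C * (P (w j) a)^*)); split.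
  apply/matrixP => a b; rewrite AE mul_mx_diag !mxE.
  rewrite (reindex_inj (perm_inj (s := s^-1%g))) /=.
  under eq_bigr do rewrite !mxE DE permKV.
  transitivity (\sum_(i < p | (i < 2)%N)
    ((P (s^-1%g i) a)^* * t%:C%C * P (s^-1%g i) b)).
    rewrite [RHS]big_mkcond /=; apply: eq_bigr => i _.
    by case: ifP; rewrite ?mulr0 ?mul0r.
  rewrite (big_ord_narrow hp); apply: eq_bigr => j _.
  by rewrite !mxE rmorphM /= conjCK cr -tt; ring.
apply/matrixP => j k; rewrite !mxE.
under eq_bigr do rewrite !mxE rmorphM /= conjCK cr mulrACA tt.
rewrite -mulr_sumr; have /unitarymxP/matrixP/(_ (w j) (w k)) := uA.
rewrite !mxE; under eq_bigr do rewrite !mxE.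
move=> ->; rewrite (inj_eq perm_inj) -(inj_eq val_inj) /= (inj_eq val_inj).
by case: eqVneq => _; rewrite ?mulr1 ?mulr0 ?mulr1n.
Qed.

Lemma frame_orbit (x : cmx R p) (V : 'M[C]_(p, 2)) : (1 < p)%N ->
  toC x = V *m V^t* -> V^t* *m V = (t%:C%C)%:M -> coadjoint_orbit lambda x.
Proof.
move=> hp xV Vt; split; first by apply/hermsymmxP; rewrite xV trC_mul trmxCK.
have -> : val lambda = [seq complex.Re z | z <- [seq e%:C%C | e <- lambda]].
  by rewrite -map_comp map_id_in.
(* The factor 'X^2 allows [char_poly_mulC] to replace V V^* by the scalar matrix V^* V. *)
apply: eigenvalues_perm; apply: (mulIf (expf_neq0 2 (negbT (polyX_eq0 _)))).
rewrite xV char_poly_mulC Vt big_map /= big_map big_enum /=.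
rewrite char_poly_trig ?scalar_mx_is_trig // !big_ord_recl big_ord0.
case: p hp => [|[|q]] //= _; rewrite !big_ord_recl /=.
rewrite [in RHS](eq_bigr (fun=> 'X)); last by move=> i _; rewrite rmorph0 subr0.
rewrite prodr_const card_ord !mxE !eqxx !mulr1n !mulr1 -addn2 exprD.
by ring.
Qed.

(** Components omitted as constant on the orbit agree at any two of its points, so the system
    determines the full lists of eigenvalues. *)
Lemma gc_systemP (x y : cmx R p) :
  coadjoint_orbit lambda x -> coadjoint_orbit lambda y ->
  (@gc_system R p lambda x = @gc_system R p lambda y) <->
  (forall m (hm : (m <= p)%N),
     eigenvalues (leading hm (toC x)) = eigenvalues (leading hm (toC y))).
Proof.
move=> Ox Oy; split=> [xy m hm|xy]; last first.
  by apply/funext => k; rewrite /gc_system /gc_fun xy.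
apply: (@eq_from_nth _ 0) => [|i].
  by rewrite [LHS]size_eigenvalues [RHS]size_eigenvalues.
rewrite [X in (_ < X)%N]size_eigenvalues => im.
(* Entry [i], counted from 0, in the minor of size [m] is the component of index (i, j) with m = (i
   + j).+1. *)
have [j mE] : exists j, m = (i + j).+1 by exists (m - i.+1)%N; lia.
rewrite {}mE in hm im *.
have ip : (i < p)%N by lia.
have jp : (j < p)%N by lia.
pose k : gc_index p := exist _ (Ordinal ip, Ordinal jp) hm.
have : gc_fun k x = gc_fun k y.
  case: (pselect (nonconstant_on (coadjoint_orbit lambda) (gc_fun k))) => [nc|].
    exact: (congr1 (@^~ (exist _ k nc)) xy).
  by move=> /contrapT[c cE]; rewrite !cE.
by rewrite /gc_fun /= (bool_irrelevance (svalP k) hm).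
Qed.

End Grassmannian.

(** * Bending *)

Section UnitaryTransport.
Local Open Scope sesquilinear_scope.
Variable R : realType.
Local Notation C := R[i].

Lemma diag_unitary n (d : 'rV[C]_n) :
  (forall s, d 0 s * (d 0 s)^* = 1) -> diag_mx d \is unitarymx.
Proof.
move=> d1; apply/unitarymxP; rewrite tr_diag_mx map_diag_mx mulmx_diag.
by apply/matrixP => i j; rewrite !mxE d1.
Qed.

Lemma ord2P (P : 'I_2 -> Prop) : P 0 -> P 1 -> forall s, P s.
Proof.
by move=> P0 P1 [[|[|//]] h]; [move: P0|move: P1]; congr P; exact/val_inj.
Qed.

Lemma mul_conj_ge0 (z : C) : 0 <= z * z^*.
Proof. by rewrite -normCK exprn_ge0. Qed.

Lemma mul_conj_eq0 (z : C) : (z * z^* == 0) = (z == 0).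
Proof. by rewrite mulf_eq0 conjC_eq0 orbb. Qed.

Lemma rv2_norm (u : 'rV[C]_2) : (u *m u^t*) 0 0 = u 0 0 * (u 0 0)^* + u 0 1 * (u 0 1)^*.
Proof. by rewrite mulmx2E !mxE. Qed.

(* The first row is [w], and the rows are orthogonal of the same norm. *)
Definition quat (w : 'rV[C]_2) : 'M[C]_2 :=
  \matrix_(i, j) (if i == 0 then w 0 j else
    if j == 0 then - (w 0 1)^* else (w 0 0)^*).

Lemma quat_mul (w : 'rV[C]_2) : quat w *m (quat w)^t* = ((w *m w^t*) 0 0)%:M.
Proof.
apply/matrixP; apply: ord2P; apply: ord2P; rewrite rv2_norm mulmx2E !mxE /=;
  by rewrite ?mulr1n ?mulr0n ?rmorphN /= ?conjCK //; ring.
Qed.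

Lemma quat_row (w : 'rV[C]_2) : row 0 (quat w) = w.
Proof. by apply/rowP => j; rewrite !mxE. Qed.

(** If the common squared norm n is nonzero, n^-1 (quat v)^* (quat u) is unitary and sends v, the
    first row of [quat v], to u; otherwise both vectors vanish. *)
Lemma unitary_transport (u v : 'rV[C]_2) :
  u *m u^t* = v *m v^t* -> exists2 G, G \is unitarymx & u = v *m G.
Proof.
move=> uv; have Qu := quat_mul u; have Qv := quat_mul v; rewrite -uv in Qv.
have [n0|n0] := eqVneq ((u *m u^t*) 0 0) 0.
  have z0 (w : 'rV[C]_2) : (w *m w^t*) 0 0 = 0 -> w = 0.
    move/eqP; rewrite rv2_norm paddr_eq0 ?mul_conj_ge0 // !mul_conj_eq0.
    move=> /andP[/eqP w0 /eqP w1]; by apply/rowP; apply: ord2P; rewrite !mxE.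
  rewrite (z0 u n0) (z0 v) -?uv //; exists 1%:M; last by rewrite mulmx1.
  by apply/unitarymxP; rewrite trmx1 map_mx1 mulmx1.
set n := (u *m u^t*) 0 0 in n0 Qu Qv.
have nr : n^* = n.
  by rewrite /n rv2_norm rmorphD !rmorphM /= !conjCK; ring.
have Qv' : (quat v)^t* *m quat v = n%:M.
  have : quat v *m (n^-1 *: (quat v)^t*) = 1%:M.
    by rewrite -scalemxAr Qv scale_scalar_mx mulVf.
  move=> /mulmx1C; rewrite -scalemxAl => QQ.
  by rewrite -[RHS]scalemx1 -QQ scalerA mulfV // scale1r.
exists (n^-1 *: ((quat v)^t* *m quat u)); last first.
  rewrite -scalemxAr mulmxA -{1}(quat_row v) -row_mul Qv -row_mul mul_scalar_mx.
  by rewrite linearZ /= quat_row scalerA mulVf // scale1r.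
apply/unitarymxP; rewrite linearZ /= map_mxZ trC_mul trmxCK fmorphV /= nr.
rewrite -scalemxAl -scalemxAr scalerA mulmxA -[_ *m quat u *m _]mulmxA Qu.
by rewrite mul_mx_scalar -scalemxAl Qv' scalerA scale_scalar_mx; congr (_%:M); field.
Qed.

End UnitaryTransport.

(** * Rotations about the diagonals, and the recovery of their phases *)

Section Bending.
Local Open Scope sesquilinear_scope.
Variables (R : realType) (p : nat).
Local Notation C := R[i].
Variable V0 : 'M[C]_(p, 2).

Local Notation B k := (spectralmx (gram k V0)).
Local Notation e k := (spectral_diag (gram k V0)).

(* Right multiplication by [bend_step ph k] commutes with the [k]-th partial sum,
   and multiplies its eigenvectors by the phases [ph k]. *)
Definition bend_step (ph : nat -> 'rV[C]_2) (k : nat) : 'M[C]_2 :=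
  (B k)^t* *m diag_mx (ph k) *m B k.

(** Row [i] of [bend ph] is row [i] of V0 times the product of the steps i, ..., 1, 0, so step [k]
    acts on the rows of index at least [k]. *)
Fixpoint bend_frame (ph : nat -> 'rV[C]_2) (k : nat) : 'M[C]_2 :=
  if k is k'.+1 then bend_step ph k' *m bend_frame ph k' else 1%:M.

Definition bend (ph : nat -> 'rV[C]_2) : 'M[C]_(p, 2) :=
  \matrix_(i < p) (row i V0 *m bend_frame ph i.+1).

(** The components of row [i] in the eigenbasis of the sum of the rows before it. *)
Definition coef (i : 'I_p) : 'rV[C]_2 := row i V0 *m (B i)^t*.

(* The other phases are redundant: if [e i 0 s = 0], the phase does not move the
   previous rows and is undone by a unitary of C^2; if [coef i 0 s = 0], it does
   not move row [i] and may be transferred to the next step. *)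
Definition active (i : 'I_p) (s : 'I_2) : bool := e i 0 s * coef i 0 s != 0.

Definition unit_phases (ph : nat -> 'rV[C]_2) : Prop :=
  forall k s, ph k 0 s * (ph k 0 s)^* = 1.

Definition phases (ph : nat -> 'rV[C]_2) : Prop :=
  unit_phases ph /\
  (forall i s, ~~ active i s -> ph i 0 s = 1).

Lemma gram_spectral k : gram k V0 = (B k)^t* *m diag_mx (e k) *m B k.
Proof.
have hG : gram k V0 \is hermsymmx by apply/hermsymmxP; exact: gram_herm.
by have [] := spectral_decomposition hG.
Qed.

Let Bu k : B k \is unitarymx := spectral_unitarymx _.

Lemma gram_spectral_mul k : gram k V0 *m (B k)^t* = (B k)^t* *m diag_mx (e k).
Proof. by rewrite {1}gram_spectral mulmxtVK. Qed.

Lemma bend_step_mul ph k : bend_step ph k *m (B k)^t* = (B k)^t* *m diag_mx (ph k).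
Proof. by rewrite mulmxtVK. Qed.

Lemma bend_step_unitary ph k : unit_phases ph ->
  bend_step ph k \is unitarymx.
Proof.
move=> u; apply: mul_unitarymx => //; apply: mul_unitarymx; last exact/diag_unitary/u.
by rewrite trmxC_unitary.
Qed.

Lemma bend_frame_unitary ph k : unit_phases ph ->
  bend_frame ph k \is unitarymx.
Proof.
move=> u; elim: k => [|k IHk] /=; last exact/mul_unitarymx/IHk/bend_step_unitary.
by apply/unitarymxP; rewrite trmx1 map_mx1 mulmx1.
Qed.

Lemma bend_step_comm ph k : unit_phases ph ->
  (bend_step ph k)^t* *m gram k V0 *m bend_step ph k = gram k V0.
Proof.
move=> u; suff c : gram k V0 *m bend_step ph k = bend_step ph k *m gram k V0.
  by rewrite -mulmxA c mulmxA unitarymxPl ?mul1mx ?bend_step_unitary.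
rewrite /bend_step; move: (gram_spectral k) (unitarymxP (Bu k)).
move: (diag_mxC (e k) (ph k)); move: (diag_mx (ph k)) (gram k V0).
move=> h G; move: (diag_mx _) (spectralmx _) => d P dh ->.
move: (P^t*) => P' PP; rewrite -!mulmxA (mulmxA P P') PP mul1mx (mulmxA d h) dh.
by rewrite (mulmxA P P' (d *m P)) PP mul1mx !mulmxA.
Qed.

(** Step [k] leaves the sum of the first [k] rows invariant, so that sum may be conjugated by it for
    free; then row [k] undergoes the same conjugation. *)
Lemma gram_bend ph k : unit_phases ph -> (k <= p)%N ->
  gram k (bend ph) = (bend_frame ph k)^t* *m gram k V0 *m bend_frame ph k.
Proof.
move=> u; elim: k => [|k IHk] kp.
  by rewrite /gram !big_pred0 // mulmx0 mul0mx.
rewrite (gramS (Ordinal kp)) (gramS (Ordinal kp) V0) IHk ?(ltnW kp) // rowK /=.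
move: (bend_step ph k) (bend_frame ph k) (gram k V0) (row _ V0) (bend_step_comm k u).
move=> E F G r EG; rewrite mulmxDr mulmxDl !trC_mul -{1}EG.
by move: (F^t*) (E^t*) (r^t*) => F' E' r'; rewrite !mulmxA.
Qed.

Lemma bend_tr ph k : unit_phases ph -> (k <= p)%N ->
  \tr (gram k (bend ph)) = \tr (gram k V0) /\
  \tr (gram k (bend ph) *m gram k (bend ph)) = \tr (gram k V0 *m gram k V0).
Proof.
move=> u kp; rewrite gram_bend //.
move: (bend_frame ph k) (gram k V0) (bend_frame_unitary k u) => F G /unitarymxP.
move: (F^t*) => F' FF; split; first by rewrite -mulmxA mxtrace_mulC -mulmxA FF mulmx1.
by rewrite -!mulmxA (mulmxA F) FF mul1mx mxtrace_mulC -!mulmxA FF mulmx1.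
Qed.

(** If x = W W^* for a bent frame W and [Y] holds the rows of W before [k], then row [k] of x Y is
    w_k M_k. With [F] undone and in the eigenbasis, its components are coefficient times phase times
    eigenvalue, and division isolates the phase of an active slot. *)
Definition unbend_phase (x : 'M[C]_p) (k : nat) (Y : 'M[C]_(p, 2)) (F : 'M[C]_2) :
    'rV[C]_2 :=
  \row_s (if insub k is Some i then
    if active i s then
      (row i x *m Y *m F^t* *m (B k)^t*) 0 s / (e k 0 s * coef i 0 s)
    else 1 else 1).

(* The state is made of the rows [< k] of the frame (the others being zero) and
   of the [k]-th bending matrix. *)
Fixpoint unbend (x : 'M[C]_p) (k : nat) : 'M[C]_(p, 2) * 'M[C]_2 :=
  if k is k'.+1 then
    let: (Y, F) := unbend x k' in
    let F' := bend_step (fun=> unbend_phase x k' Y F) k' *m F in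
    (\matrix_(i < p) (if i == k' :> nat then row i V0 *m F' else row i Y), F')
  else (0, 1%:M).

Definition unbend_phases (x : 'M[C]_p) (k : nat) : 'rV[C]_2 :=
  unbend_phase x k (unbend x k).1 (unbend x k).2.

Lemma unbend_phase_bend ph (i : 'I_p) (Y : 'M[C]_(p, 2)) : phases ph ->
  (bend ph)^t* *m Y = gram i (bend ph) ->
  unbend_phase (bend ph *m (bend ph)^t*) i Y (bend_frame ph i) = ph i.
Proof.
move=> [u n] WY; apply/rowP => s; rewrite mxE valK.
have [a|na] := ifPn; last by rewrite n.
have Fu := bend_frame_unitary i u.
apply: (canLR (mulfK a)); rewrite row_mul -[_ *m Y]mulmxA WY gram_bend 1?ltnW //.
rewrite rowK /=; have -> : row i V0 *m (bend_step ph i *m bend_frame ph i) *m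
    ((bend_frame ph i)^t* *m gram i V0 *m bend_frame ph i) *m
    (bend_frame ph i)^t* *m (B i)^t* = coef i *m diag_mx (ph i) *m diag_mx (e i).
  rewrite /coef; move: (bend_step_mul ph i) (gram_spectral_mul i) (unitarymxP Fu).
  move: (gram i V0) (diag_mx (e i)) ((B i)^t*) => G d P'.
  move: (bend_step ph i) (bend_frame ph i) (diag_mx (ph i)) (row i V0) => E F h r.
  move: (F^t*) => F' EP GP FF; rewrite -!mulmxA !(mulmxA F) FF !mul1mx.
  by rewrite GP (mulmxA E) EP -mulmxA.
by rewrite !mul_mx_diag !mxE; ring.
Qed.

Lemma truncated_frame (k : nat) (W : 'M[C]_(p, 2)) :
  W^t* *m (\matrix_(i < p) (if (i < k)%N then row i W else 0)) = gram k W.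
Proof.
apply/matrixP => a b; rewrite gramE mxE [RHS]big_mkcond; apply: eq_bigr => j _.
by rewrite !mxE /=; case: ifP => _; rewrite ?mxE ?mulr0.
Qed.

(** The phases are recovered in order: the first [k] rows give the phases of step [k], which in turn
    give row [k]. *)
Lemma unbendE ph k : phases ph -> (k <= p)%N ->
  unbend (bend ph *m (bend ph)^t*) k =
  (\matrix_(i < p) (if (i < k)%N then row i (bend ph) else 0), bend_frame ph k).
Proof.
move=> php; elim: k => [|k IHk] kp.
  by congr (_, _); apply/row_matrixP => i; rewrite rowK row0.
rewrite /= (IHk (ltnW kp)) /bend_step.
rewrite (@unbend_phase_bend ph (Ordinal kp) _ php (truncated_frame _ _)).
congr (_, _); apply/row_matrixP => i; rewrite rowK [RHS]rowK ltnS leq_eqVlt.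
by have [E|_] := eqVneq (i : nat) k; rewrite rowK // E.
Qed.

Lemma unbend_phasesE ph (i : 'I_p) : phases ph ->
  unbend_phases (bend ph *m (bend ph)^t*) i = ph i.
Proof.
move=> php; rewrite /unbend_phases (unbendE php (ltnW (ltn_ord i))).
exact: (unbend_phase_bend php (truncated_frame _ _)).
Qed.
End Bending.

(** * Bending reaches every frame with the same Gelfand-Cetlin values *)

Section BendingOnto.
Local Open Scope sesquilinear_scope.
Variables (R : realType) (p : nat).
Local Notation C := R[i].

Lemma gram_mulr k (W : 'M[C]_(p, 2)) (A : 'M[C]_2) :
  gram k (W *m A) = A^t* *m gram k W *m A.
Proof.
rewrite /gram mulmx_sumr mulmx_suml; apply: eq_bigr => i _.
by rewrite row_mul trC_mul !mulmxA.
Qed.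

Lemma eq_gram k (W W' : 'M[C]_(p, 2)) :
  (forall i : 'I_p, (i < k)%N -> row i W = row i W') -> gram k W = gram k W'.
Proof. by move=> WW'; apply: eq_bigr => i /WW' ->. Qed.

Lemma mxtrace_rank1 (r : 'rV[C]_2) : \tr (r^t* *m r) = (r *m r^t*) 0 0.
Proof. by rewrite mxtrace_mulC /mxtrace big_ord1. Qed.

(** For a partial sum G and the next row r, this isolates r G r^*, the one term that neither tr G^2
    nor the norm of r determines. *)
Lemma mxtrace_sqrD_rank1 (G : 'M[C]_2) (r : 'rV[C]_2) :
  \tr ((G + r^t* *m r) *m (G + r^t* *m r)) =
  \tr (G *m G) + 2 * (r *m G *m r^t*) 0 0 + (r *m r^t*) 0 0 ^+ 2.
Proof.
have r1 (u : 'rV[C]_2) (v : 'cV[C]_2) : \tr (v *m u) = (u *m v) 0 0.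
  by rewrite mxtrace_mulC /mxtrace big_ord1.
move: (r^t*) => r'; rewrite mulmxDl !mulmxDr !linearD /=.
have -> : \tr (G *m (r' *m r)) = (r *m G *m r') 0 0 by rewrite mulmxA r1 mulmxA.
have -> : \tr (r' *m r *m G) = (r *m G *m r') 0 0 by rewrite -mulmxA r1.
have -> : \tr (r' *m r *m (r' *m r)) = (r *m r') 0 0 ^+ 2.
  by rewrite -mulmxA r1 mulmxA -(mulmxA (r *m r')) mxE big_ord1.
by ring.
Qed.

(** In the eigenbasis the last two hypotheses are linear equations on the two squared moduli, with
    coefficients (1, 1) and (d_0, d_1), hence independent. *)
Lemma coef_norm (P : 'M[C]_2) (d : 'rV[C]_2) (w v : 'rV[C]_2) :
  P \is unitarymx -> d 0 0 != d 0 1 ->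
  w *m w^t* = v *m v^t* ->
  w *m (P^t* *m diag_mx d *m P) *m w^t* = v *m (P^t* *m diag_mx d *m P) *m v^t* ->
  [/\ (w *m P^t*) 0 0 * ((w *m P^t*) 0 0)^* = (v *m P^t*) 0 0 * ((v *m P^t*) 0 0)^* &
      (w *m P^t*) 0 1 * ((w *m P^t*) 0 1)^* = (v *m P^t*) 0 1 * ((v *m P^t*) 0 1)^*].
Proof.
move=> uP dd; set b := w *m P^t*; set c := v *m P^t*.
have wE : w = b *m P by rewrite mulmxKtV.
have vE : v = c *m P by rewrite mulmxKtV.
clearbody b c.
have N (a : 'rV[C]_2) : (a *m P) *m (a *m P)^t* = a *m a^t*.
  by rewrite trC_mul mulmxA mulmxtVK.
have Q (a : 'rV[C]_2) : (a *m P) *m (P^t* *m diag_mx d *m P) *m (a *m P)^t* =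
    a *m diag_mx d *m a^t*.
  move: (unitarymxP uP); rewrite trC_mul; move: (diag_mx d) (P^t*) (a^t*) => D P' a' PP.
  by rewrite -!mulmxA (mulmxA P P' a') PP mul1mx (mulmxA P P') PP mul1mx.
have D (a : 'rV[C]_2) : (a *m diag_mx d *m a^t*) 0 0 =
    d 0 0 * (a 0 0 * (a 0 0)^*) + d 0 1 * (a 0 1 * (a 0 1)^*).
  by rewrite mul_mx_diag mulmx2E !mxE; ring.
have e00 (A A' : 'M[C]_1) : A = A' -> A 0 0 = A' 0 0 by move=> ->.
rewrite wE vE !N !Q => /e00 E1 /e00 E2; move: E1 E2; rewrite !D !rv2_norm.
move: dd; rewrite -subr_eq0; move: (d 0 0) (d 0 1) => d0 d1 dd.
move: (_ * (b 0 0)^*) (_ * (b 0 1)^*) (_ * (c 0 0)^*) (_ * (c 0 1)^*).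
move=> b0 b1 c0 c1 E1 E2; split; apply: (mulfI dd); apply/eqP; rewrite -subr_eq0.
  have -> : (d0 - d1) * b0 - (d0 - d1) * c0 =
    (d0 * b0 + d1 * b1 - (d0 * c0 + d1 * c1)) - d1 * (b0 + b1 - (c0 + c1)) by ring.
  by rewrite E1 E2 !subrr mulr0 subrr.
have -> : (d0 - d1) * b1 - (d0 - d1) * c1 =
  d0 * (b0 + b1 - (c0 + c1)) - (d0 * b0 + d1 * b1 - (d0 * c0 + d1 * c1)) by ring.
by rewrite E1 E2 !subrr mulr0 subrr.
Qed.
Variable V0 : 'M[C]_(p, 2).
Local Notation B k := (spectralmx (gram k V0)).
Local Notation e k := (spectral_diag (gram k V0)).

(* The square of the difference of the two eigenvalues of [gram k W], that is, of
   the length of a diagonal of the polygon. *)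
Definition polygon_diag (k : nat) (W : 'M[C]_(p, 2)) : C :=
  2 * \tr (gram k W *m gram k W) - \tr (gram k W) ^+ 2.

(** By [leading_eigenvaluesP], W W^* and V0 V0^* then have the same eigenvalues in every leading
    minor. *)
Definition same_gc (W : 'M[C]_(p, 2)) : Prop :=
  forall k, (k <= p)%N -> \tr (gram k W) = \tr (gram k V0) /\
    \tr (gram k W *m gram k W) = \tr (gram k V0 *m gram k V0).

Lemma polygon_diag_spectral k : polygon_diag k V0 = (e k 0 0 - e k 0 1) ^+ 2.
Proof.
have uB : B k \is unitarymx := spectral_unitarymx _.
rewrite /polygon_diag; move: (gram_spectral V0 k) uB.
move: (gram k V0) (e k) (spectralmx _) => G d P -> uP.
have -> : P^t* *m diag_mx d *m P *m (P^t* *m diag_mx d *m P) =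
    P^t* *m (diag_mx d *m diag_mx d *m P).
  move: (unitarymxP uP); move: (P^t*) (diag_mx d) => P' D PP.
  by rewrite -!mulmxA (mulmxA P P') PP mul1mx.
rewrite -(mulmxA (P^t*) (diag_mx d) P) !(mxtrace_mulC (P^t*)) !mulmxtVK //.
rewrite mulmx_diag !mxtrace2 !mxE /= !mulr1n.
by ring.
Qed.

Lemma eq_bend_frame (ph ph' : nat -> 'rV[C]_2) k :
  (forall j, (j < k)%N -> ph j = ph' j) -> bend_frame V0 ph k = bend_frame V0 ph' k.
Proof.
elim: k => //= k IHk pp; rewrite /bend_step pp ?ltnSn // IHk // => j jk.
by apply: pp; rewrite ltnW.
Qed.

(** Both traces are compared for [i] and [i.+1] rows: the trace yields the norm of the new row, and
    the trace of the square then yields the value on it of the previous sum. *)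
Lemma gram_norm_step (i : 'I_p) (W : 'M[C]_(p, 2)) : same_gc W ->
  row i W *m (row i W)^t* = row i V0 *m (row i V0)^t* /\
  row i W *m gram i W *m (row i W)^t* = row i V0 *m gram i V0 *m (row i V0)^t*.
Proof.
move=> WV; have [t1 t2] := WV i (ltnW (ltn_ord i)); have [t3 t4] := WV i.+1 (ltn_ord i).
have m11 (A A' : 'M[C]_1) : A 0 0 = A' 0 0 -> A = A'.
  by move=> AA; rewrite [A]mx11_scalar [A']mx11_scalar AA.
rewrite !gramS in t3 t4; move: (gram i W) (gram i V0) (row i W) (row i V0) t1 t2 t3 t4.
move=> G G' r r'; rewrite !mxtrace_sqrD_rank1 !linearD /= !mxtrace_rank1.
move=> -> -> /addrI /m11 -> /addIr /addrI /mulfI rG; split; first by [].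
by apply/m11/rG; rewrite pnatr_eq0.
Qed.

(* The phases are read off from the components of row [k] of [W]; a phase along
   the kernel of [gram k V0] does not move the previous rows and is absorbed
   in [G]. *)
Lemma bend_onto_step k (W : 'M[C]_(p, 2)) ph G :
  same_gc W -> (k < p)%N -> polygon_diag k V0 != 0 ->
  phases V0 ph -> G \is unitarymx ->
  (forall j : 'I_p, (j < k)%N -> row j W = row j (bend V0 ph) *m G) ->
  exists ph' G', [/\ phases V0 ph', G' \is unitarymx &
    forall j : 'I_p, (j < k.+1)%N -> row j W = row j (bend V0 ph') *m G'].
Proof.
move=> WV kp dk [u n] uG WG; pose i := Ordinal kp.
have uB : B k \is unitarymx := spectral_unitarymx _.
have [F FE] : exists F, F = bend_frame V0 ph k by exists (bend_frame V0 ph k).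
have uF : F \is unitarymx by rewrite FE; exact: bend_frame_unitary.
(* [H] carries the partial sum of V0 to that of W. Row [k] of W is compared with that of V0 after
   undoing [H]; [b] and [c] are their components in the eigenbasis. *)
have [H HE] : exists H, H = F *m G by exists (F *m G).
have uH : H \is unitarymx by rewrite HE; exact: mul_unitarymx.
have gW : gram k W = H^t* *m gram k V0 *m H.
  rewrite (@eq_gram k W (bend V0 ph *m G)); last by move=> j /WG; rewrite row_mul.
  rewrite gram_mulr gram_bend ?(ltnW kp) // -FE HE trC_mul.
  by move: (gram k V0) (G^t*) (F^t*) (F) => *; rewrite !mulmxA.
have [N1 N2] := @gram_norm_step i W WV.
have [w wE] : exists w, row i W = w *m H.
  by exists (row i W *m H^t*); rewrite mulmxKtV.
have [b bw] : exists b, b = w *m (B k)^t* by exists (w *m (B k)^t*).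
have [c cE] : exists c, c = coef V0 i by exists (coef V0 i).
have bE : row i W = b *m B k *m H by rewrite wE bw mulmxKtV.
have hb s : b 0 s * (b 0 s)^* = c 0 s * (c 0 s)^*.
  have [] := @coef_norm (B k) (e k) w (row i V0) uB.
  - by rewrite -subr_eq0; move: dk; rewrite polygon_diag_spectral expf_eq0.
  - by rewrite -N1 wE trC_mul mulmxA mulmxtVK.
  - rewrite -gram_spectral -[RHS]N2 /= gW wE trC_mul.
    move: (unitarymxP uH); move: (gram k V0) (w) (w^t*) (H) (H^t*) => A a a' K K' KK.
    by rewrite -!mulmxA (mulmxA K K' a') KK mul1mx (mulmxA K K') KK mul1mx.
  by rewrite bw cE; move: s; apply: ord2P.
(* Equal moduli make the quotient a phase; where [c] vanishes, so does [b], and the value 1 serves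
   as well as any. *)
pose phi s : C := if c 0 s == 0 then 1 else b 0 s / c 0 s.
have phi1 s : phi s * (phi s)^* = 1.
  rewrite /phi; case: eqP => [_|/eqP c0]; first by rewrite rmorph1 mulr1.
  rewrite fmorph_div mulf_div hb divff // mulf_neq0 // conjC_eq0 //.
have bphi s : b 0 s = c 0 s * phi s.
  rewrite /phi; case: eqP => [c0|/eqP c0]; last by rewrite mulrC divfK.
  by apply/eqP; rewrite c0 mul0r -mul_conj_eq0 hb c0 mul0r.
(* [phi] is the product of [f] and [d], with [d] taking the phases along the kernel of the partial
   sum. *)
pose d : 'rV[C]_2 := \row_s (if e k 0 s == 0 then phi s else 1).
pose f : 'rV[C]_2 := \row_s (if e k 0 s == 0 then 1 else phi s).
have one1 : 1 * 1^* = 1 :> C by rewrite rmorph1 mulr1.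
have d1 s : d 0 s * (d 0 s)^* = 1 by rewrite mxE; case: ifP.
have f1 s : f 0 s * (f 0 s)^* = 1 by rewrite mxE; case: ifP.
pose ph' j := if j == k then f else ph j.
have FF : bend_frame V0 ph' k = F.
  by rewrite FE; apply: eq_bend_frame => j jk; rewrite /ph' ltn_eqF.
(* The phases [d] live in the eigenbasis of the unbent partial sum, so they are conjugated by
   [B k *m F] before meeting [G]. *)
exists ph', (F^t* *m (B k)^t* *m diag_mx d *m B k *m H); split.
- split=> [j s|j s]; rewrite /ph'; first by case: ifP.
  case: eqP => [jk|_]; last exact: n.
  have {jk} -> : j = i by exact/val_inj.
  rewrite /active negbK mulf_eq0 -cE => z; rewrite mxE /phi; case/orP: z => -> //.
  by case: ifP.
- have uFc : F^t* \is unitarymx := etrans (trmxC_unitary F) uF.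
  have uBc : (B k)^t* \is unitarymx := etrans (trmxC_unitary (B k)) uB.
  exact: mul_unitarymx (mul_unitarymx (mul_unitarymx (mul_unitarymx uFc uBc)
    (diag_unitary d1)) uB) uH.
move=> j; rewrite ltnS leq_eqVlt => /orP[/eqP jk|jk].
  have {jk} -> : j = i by exact/val_inj.
  rewrite bE rowK /= FF /bend_step /ph' eqxx.
  have -> : b = c *m diag_mx f *m diag_mx d.
    apply/rowP => s; rewrite !mul_mx_diag !mxE bphi -mulrA; congr (_ * _).
    by case: ifP; rewrite ?mulr1 ?mul1r.
  rewrite cE /coef; move: (unitarymxP uF) (unitarymxP uB).
  move: (diag_mx f) (diag_mx d) (row i V0) (B k) ((B k)^t*) (F) (F^t*) (H).
  move=> f' d' v B'' B' F'' F' H' FF' BB'.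
  by rewrite -!mulmxA (mulmxA F'' F') FF' mul1mx (mulmxA B'' B') BB' mul1mx.
have {FF} -> : row j (bend V0 ph') = row j (bend V0 ph).
  rewrite !rowK; congr (_ *m _); apply: eq_bend_frame => l lj.
  by rewrite /ph' ltn_eqF // (leq_trans lj).
rewrite WG //.
(* The partial sum of [Z] is diagonal: a zero eigenvalue is a vanishing sum of squared moduli, so
   that column of [Z] is zero on the rows before [k], and [d] fixes these rows. *)
have [Z ZE] : exists Z, Z = bend V0 ph *m (F^t* *m (B k)^t*) by eexists.
have ZZ : gram k Z = diag_mx (e k).
  rewrite ZE gram_mulr gram_bend ?(ltnW kp) // -FE trC_mul !trmxCK.
  move: (gram_spectral V0 k) (unitarymxP uF) (unitarymxP uB).
  move: (gram k V0) (diag_mx (e k)) (B k) ((B k)^t*) (F) (F^t*).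
  move=> A D B'' B' F'' F' -> FF BB.
  rewrite -!mulmxA (mulmxA F'' F' B') FF mul1mx (mulmxA F'' F') FF mul1mx.
  by rewrite BB mulmx1 (mulmxA B'' B') BB mul1mx.
have Zd : row j Z *m diag_mx d = row j Z.
  apply/rowP => s; rewrite mul_mx_diag !mxE; case: eqP => [es|_]; last by rewrite mulr1.
  have /matrixP/(_ s s) := ZZ; rewrite gramE mxE es mul0rn => /psumr_eq0P Z0.
  have /eqP := Z0 (fun l _ => etrans (congr1 _ (mulrC _ _)) (mul_conj_ge0 _)) _ jk.
  by rewrite mulrC mul_conj_eq0 => /eqP ->; rewrite mul0r.
move: Zd; rewrite ZE row_mul HE.
move: (unitarymxP uF) (unitarymxP uB) (unitarymxPl uF) (unitarymxPl uB).
move: (row j _) (diag_mx d) (B k) ((B k)^t*) (F) (F^t*) => z D B'' B' F'' F' FF BB FF' BB' Zd.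
rewrite !mulmxA; move: Zd; rewrite !mulmxA => ->.
by rewrite -(mulmxA _ B') BB' mulmx1 -(mulmxA _ F') FF' mulmx1.
Qed.

Lemma bend_onto (W : 'M[C]_(p, 2)) : same_gc W ->
  (forall k, (0 < k < p)%N -> polygon_diag k V0 != 0) ->
  exists ph G, [/\ phases V0 ph, G \is unitarymx & W = bend V0 ph *m G].
Proof.
move=> WV dV; suff: forall k, (k <= p)%N -> exists ph G,
    [/\ phases V0 ph, G \is unitarymx &
    forall j : 'I_p, (j < k)%N -> row j W = row j (bend V0 ph) *m G].
  move=> /(_ p (leqnn p))[ph [G [php uG WG]]]; exists ph, G; split=> //.
  by apply/row_matrixP => j; rewrite row_mul WG.
have one1 : 1 * 1^* = 1 :> C by rewrite rmorph1 mulr1.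
have c1 : phases V0 (fun=> const_mx 1) by split=> [k s|i s _]; rewrite mxE.
case=> [_|].
  exists (fun=> const_mx 1), 1%:M; split=> //.
  by rewrite -diag_const_mx diag_unitary // => s; rewrite mxE.
elim=> [p0|k IHk kp]; last first.
  have [ph [G [php uG WG]]] := IHk (ltnW kp).
  exact: (bend_onto_step WV kp (dV k.+1 kp) php uG WG).
(* The sum of no rows is zero and has no distinct eigenvalues; the first row is instead matched by a
   unitary alone. *)
have [N _] := @gram_norm_step (Ordinal p0) W WV.
have [G uG GE] := unitary_transport N.
have F1 : bend_frame V0 (fun=> const_mx 1) 1 = 1%:M.
  rewrite /= /bend_step diag_const_mx !mulmx1 unitarymxPl //.
  exact: spectral_unitarymx.
exists (fun=> const_mx 1), G; split=> // j j0; rewrite rowK.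
have -> : j = Ordinal p0 by apply/val_inj => /=; case: (nat_of_ord j) j0.
by rewrite F1 mulmx1.
Qed.

End BendingOnto.

(** * The fiber as a torus of phases *)

Section FiberTorus.
Local Open Scope sesquilinear_scope.
Variables (R : realType) (p : nat).
Local Notation C := R[i].
Variable V0 : 'M[C]_(p, 2).

(** One circle factor per free phase; the inactive phases are frozen at 1. *)
Definition slots : {set 'I_p * 'I_2} := [set s | active V0 s.1 s.2].

Definition slot (j : 'I_#|slots|) : 'I_p * 'I_2 := enum_val j.

Definition phases_of_torus (z : 'M[R]_(#|slots|, 2)) (k : nat) : 'rV[C]_2 :=
  \row_s (if [pick j : 'I_#|slots| |
      ((slot j).1 == k :> nat) && ((slot j).2 == s)] is Some j
    then Complex (z j ord0) (z j ord_max) else 1).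

Definition torus_of_phases (ph : nat -> 'rV[C]_2) : 'M[R]_(#|slots|, 2) :=
  \matrix_(j < #|slots|, c < 2) (if c == ord0 then @complex.Re R else @complex.Im R)
    (ph (slot j).1 0 (slot j).2).

Lemma phases_of_torusE z (j : 'I_#|slots|) :
  phases_of_torus z (slot j).1 0 (slot j).2 = Complex (z j ord0) (z j ord_max).
Proof.
rewrite mxE; case: pickP => [j' /andP[/eqP e1 /eqP e2]|/(_ j)]; last by rewrite !eqxx.
suff -> : j' = j by [].
by apply: (@enum_val_inj _ (mem slots)); apply: injective_projections => //; exact: val_inj.
Qed.

Lemma unit_complex (z : C) :
  (z * z^* == 1) = (complex.Re z ^+ 2 + complex.Im z ^+ 2 == 1).
Proof.
rewrite -normCK -add_Re2_Im2 -(rmorph1 (real_complex R)).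
exact: (inj_eq (@complexI R)).
Qed.

Lemma phases_of_torusP z : torus z -> phases V0 (phases_of_torus z).
Proof.
move=> tz; split=> [k s|i s na]; rewrite mxE.
  case: pickP => [j _|_]; last by rewrite rmorph1 mulr1.
  by apply/eqP; rewrite unit_complex /= tz.
case: pickP => // j /andP[/eqP/val_inj e1 /eqP e2]; have := enum_valP j.
by rewrite inE -/(slot j) e1 e2 (negPf na).
Qed.

Lemma torus_of_phasesP ph : phases V0 ph -> torus (torus_of_phases ph).
Proof. by move=> [u _] j; rewrite !mxE /=; apply/eqP; rewrite -unit_complex u. Qed.

Lemma torus_of_phasesK ph : phases V0 ph ->
  forall k, (k < p)%N -> phases_of_torus (torus_of_phases ph) k = ph k.
Proof.
move=> [u n] k kp; apply/rowP => s; rewrite mxE.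
case: pickP => [j /andP[/eqP e1 /eqP e2]|na].
  by rewrite !mxE /= e1 e2; case: (ph k 0 s).
rewrite (n (Ordinal kp)) //; apply/negP => a.
have sk : (Ordinal kp, s) \in slots by rewrite inE.
by have := na (enum_rank_in sk (Ordinal kp, s)); rewrite /slot enum_rankK_in //= !eqxx.
Qed.

Lemma phases_of_torusK z (ph : nat -> 'rV[C]_2) :
  (forall i : 'I_p, ph i = phases_of_torus z i) ->
  torus_of_phases ph = z.
Proof.
move=> pz; apply/matrixP => j c; rewrite mxE pz phases_of_torusE /=.
have [->|c0] //= := eqVneq c ord0.
by congr (z _ _); apply/val_inj; case: c c0 => [[|[|]]].
Qed.

Lemma eq_bend ph ph' : (forall k, (k < p)%N -> ph k = ph' k) ->
  bend V0 ph = bend V0 ph'.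
Proof.
move=> pp; apply/row_matrixP => i; rewrite !rowK (@eq_bend_frame _ _ V0 ph ph') //.
by move=> j ji; rewrite pp // (leq_trans ji).
Qed.

Definition fiber_of_torus (z : 'M[R]_(#|slots|, 2)) : cmx R p :=
  ofC (bend V0 (phases_of_torus z) *m (bend V0 (phases_of_torus z))^t*).

Definition torus_of_fiber (x : cmx R p) : 'M[R]_(#|slots|, 2) :=
  torus_of_phases (unbend_phases V0 (toC x)).

Lemma smooth_ofC (U : normedModType R) (F : U -> 'M[C]_p) :
  smoothCmx F -> smooth (fun x => ofC (F x)).
Proof.
move=> sF; apply: (@smooth_pairmx R U _ _ _ _
  (fun x => (ofC (F x)).1) (fun x => (ofC (F x)).2)).
  by move=> i j; apply: smooth_eq (sF i j).1 => x; rewrite !mxE.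
by move=> i j; apply: smooth_eq (sF i j).2 => x; rewrite !mxE.
Qed.

Lemma smoothCmx_toC (U : normedModType R) (F : {linear U -> cmx R p}) :
  continuous F -> smoothCmx (fun x => toC (F x)).
Proof.
move=> cF i j; split.
  apply: (smooth_eq (g := fun x => (F x).1 i j)) => [x|]; first by rewrite mxE.
  apply: (@smooth_mxcoord R U _ _ [the {linear _ -> _} of fst \o F]) => x.
  by apply: continuous_comp; [exact: cF|exact: cvg_fst].
apply: (smooth_eq (g := fun x => (F x).2 i j)) => [x|]; first by rewrite mxE.
apply: (@smooth_mxcoord R U _ _ [the {linear _ -> _} of snd \o F]) => x.
by apply: continuous_comp; [exact: cF|exact: cvg_snd].
Qed.

Lemma smooth_bend_step (U : normedModType R) (ph : U -> nat -> 'rV[C]_2) k :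
  smoothCmx (fun x => ph x k) -> smoothCmx (fun x => bend_step V0 (ph x) k).
Proof.
move=> sp; apply: smoothCmxM; last exact: smoothCmx_cst.
by apply: smoothCmxM; [exact: smoothCmx_cst|exact: smoothCmx_diag].
Qed.

Lemma smooth_fiber_of_torus : smooth fiber_of_torus.
Proof.
have sp k : smoothCmx (fun z => phases_of_torus z k).
  move=> i s; rewrite (ord1 i); case E : [pick j : 'I_#|slots| |
      ((slot j).1 == k :> nat) && ((slot j).2 == s)] => [j|].
    apply: (eq_smoothC (G := fun z : 'M[R]__ => Complex (z j ord0) (z j ord_max))).
      by move=> z; rewrite mxE E.
    by split; apply: (@smooth_mxcoord R _ _ _ idfun) => z; exact: cvg_id.
  by apply: eq_smoothC (smoothC_cst _ 1) => z; rewrite mxE E.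
have sF k : smoothCmx (fun z => bend_frame V0 (phases_of_torus z) k).
  elim: k => [|k IHk]; first exact: smoothCmx_cst.
  exact: smoothCmxM (smooth_bend_step (sp k)) IHk.
have sW : smoothCmx (fun z => bend V0 (phases_of_torus z)).
  move=> i s; have := smoothCmxM (smoothCmx_cst _ (row i V0)) (sF i.+1).
  by move=> /(_ 0 s); apply: eq_smoothC => z; rewrite mxE.
by apply: smooth_ofC; apply: smoothCmxM => //; exact: smoothCmx_trC.
Qed.

(** The only divisions are by constants attached to V0, so the recovered phases are polynomial in
    the real and imaginary parts of the entries and extend smoothly to the whole ambient space. *)
Lemma smooth_torus_of_fiber : smooth torus_of_fiber.
Proof.
have sx : smoothCmx (@toC R p) by apply: (@smoothCmx_toC _ idfun) => x; exact: cvg_id.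
have sphase k (Y : cmx R p -> 'M[C]_(p, 2)) (F : cmx R p -> 'M[C]_2) :
    smoothCmx Y -> smoothCmx F ->
    smoothCmx (fun x => unbend_phase V0 (toC x) k (Y x) (F x)).
  move=> sY sF i s; rewrite (ord1 i).
  have c1 : smoothC (fun _ : cmx R p => 1 : C) by exact: smoothC_cst.
  case Ek : (insub k : option 'I_p) => [l|]; last first.
    by apply: eq_smoothC c1 => x; rewrite mxE Ek.
  have [a|na] := boolP (active V0 l s); last first.
    by apply: eq_smoothC c1 => x; rewrite mxE Ek (negPf na).
  have sB := smoothCmx_cst (cmx R p) ((spectralmx (gram k V0))^t*).
  have := smoothCmxM (smoothCmxM (smoothCmxM (smoothCmx_row l sx) sY)
    (smoothCmx_trC sF)) sB.
  move=> /(_ 0 s) /smoothCM /(_ (smoothC_cst _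
    (spectral_diag (gram k V0) 0 s * coef V0 l 0 s)^-1)).
  by apply: eq_smoothC => x; rewrite mxE Ek a.
have sU k : smoothCmx (fun x => (unbend V0 (toC x) k).1) /\
            smoothCmx (fun x => (unbend V0 (toC x) k).2).
  elim: k => [|k [sY sF]]; first by split; exact: smoothCmx_cst.
  have sF' : smoothCmx (fun x => (unbend V0 (toC x) k.+1).2).
    pose ph (x : cmx R p) := unbend_phases V0 (toC x).
    have := smoothCmxM (@smooth_bend_step _ (fun x _ => ph x k) k (sphase k _ _ sY sF)) sF.
    move=> + i j => /(_ i j); apply: eq_smoothC => x /=.
    by rewrite /ph /unbend_phases; case: (unbend _ _ k).
  split=> // i j; have [ik|ik] := eqVneq (i : nat) k.
    have := smoothCmxM (smoothCmx_cst _ (row i V0)) sF'.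
    move=> /(_ 0 j); apply: eq_smoothC => x /=.
    by case: (unbend _ _ k) => Y F; rewrite /= mxE ik eqxx.
  apply: eq_smoothC (sY i j) => x /=.
  by case: (unbend _ _ k) => Y F; rewrite /= !mxE (negPf ik) mxE.
apply: smooth_mx => j c; have [sY sF] := sU (slot j).1.
have [s1 s2] := sphase (slot j).1 _ _ sY sF 0 (slot j).2.
have [c0|c0] := boolP (c == ord0).
  by apply: smooth_eq s1 => x; rewrite mxE c0.
by apply: smooth_eq s2 => x; rewrite mxE (negPf c0).
Qed.

Variable t : R.
Local Notation lambda := (gr2_spectrum p t).

Lemma fiber_torus (x0 : cmx R p) : (1 < p)%N -> 0 < t ->
  toC x0 = V0 *m V0^t* -> V0^t* *m V0 = (t%:C%C)%:M ->
  (forall k, (0 < k < p)%N -> polygon_diag k V0 != 0) ->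
  diffeomorphic (gc_fiber (@gc_system R p lambda x0)) (@torus R #|slots|).
Proof.
move=> hp t0 x0V V0t dV; have Ox0 := frame_orbit hp x0V V0t.
exists torus_of_fiber, fiber_of_torus; split.
- exact: smooth_on_smooth smooth_torus_of_fiber.
- exact: smooth_on_smooth smooth_fiber_of_torus.
- move=> x [Ox xx0]; have [W [xW Wt]] := orbit_frame hp t0 Ox.
  have WV : same_gc V0 W.
    move=> k kp; apply/(leading_eigenvaluesP kp); rewrite -xW -x0V.
    by apply: (gc_systemP Ox Ox0).1.
  (* Every frame of the fiber is a bending of V0 up to [G], which cancels in W W^*. *)
  have [ph [G [php uG WE]]] := bend_onto WV dV.
  have xE : toC x = bend V0 ph *m (bend V0 ph)^t*.
    by rewrite xW WE trC_mul mulmxA mulmxtVK.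
  have fx : torus_of_fiber x = torus_of_phases ph.
    apply/matrixP => j c; rewrite /torus_of_fiber xE mxE [RHS]mxE.
    by rewrite (unbend_phasesE _ php).
  rewrite fx; split; first exact: torus_of_phasesP.
  by rewrite /fiber_of_torus (eq_bend (torus_of_phasesK php)) -xE toCK.
- move=> z /phases_of_torusP php; split; last first.
    apply: phases_of_torusK => i; rewrite /fiber_of_torus ofCK.
    exact: unbend_phasesE.
  have Ez : toC (fiber_of_torus z) =
    bend V0 (phases_of_torus z) *m (bend V0 (phases_of_torus z))^t* by exact: ofCK.
  (* The full sum is scalar, hence unchanged when conjugated by the unitary bending matrix. *)
  have Oz : coadjoint_orbit lambda (fiber_of_torus z).
    apply: (frame_orbit hp Ez); rewrite -gram_full (gram_bend _ php.1 (leqnn p)).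
    rewrite gram_full V0t -mulmxA mul_scalar_mx -scalemxAr unitarymxPl.
      by rewrite scale_scalar_mx mulr1.
    by apply: bend_frame_unitary; exact: php.1.
  split; first exact: Oz.
  apply/(gc_systemP Oz Ox0) => m hm; rewrite Ez x0V.
  by apply/leading_eigenvaluesP; exact: bend_tr _ php.1 hm.
Qed.

End FiberTorus.

(** * Permutations as Hamiltonian diffeomorphisms *)

Section Derivations.
Local Open Scope sesquilinear_scope.
Variable R : realType.
Local Notation C := R[i].

Lemma is_derive_scale (V : normedModType R) (f : R^o -> R^o) (e : V) (r : R^o) (df : R^o) :
  is_derive r (1 : R^o) f df -> is_derive r (1 : R^o) (fun s => f s *: e) (df *: e).
Proof.
move=> fr; have dfr : differentiable f r by apply/derivable1_diffP; exact: ex_derive.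
have dfe := differentiableZl e dfr; apply: DeriveDef; first exact: diff_derivable.
by rewrite deriveE // diffZl //= -deriveE // (@derive_val _ _ _ _ _ _ _ fr).
Qed.

Lemma is_derive_linear_comp (U V : normedModType R) (h : {linear U -> V})
    (c : R^o -> U) (r : R^o) (w : U) : continuous h ->
  is_derive r (1 : R^o) c w -> is_derive r (1 : R^o) (fun s => h (c s)) (h w).
Proof.
move=> ch cr; have dc : differentiable c r by apply/derivable1_diffP; exact: ex_derive.
have dh : differentiable h (c r) by exact: linear_differentiable.
have dhc : differentiable (h \o c) r by exact: differentiable_comp.
apply: DeriveDef; first exact: diff_derivable.
rewrite deriveE // diff_comp //= diff_lin // -deriveE //.
by rewrite (@derive_val _ _ _ _ _ _ _ cr).
Qed.

Definition deriveC (r : R^o) (f : R^o -> C) (l : C) : Prop :=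
  is_derive r (1 : R^o) (fun s => complex.Re (f s) : R^o) (complex.Re l) /\
  is_derive r (1 : R^o) (fun s => complex.Im (f s) : R^o) (complex.Im l).

Lemma deriveC_unique r f l l' : deriveC r f l -> deriveC r f l' -> l = l'.
Proof.
move=> [r1 i1] [r2 i2]; apply/eqP; rewrite eq_complex; apply/andP; split; apply/eqP.
  by rewrite -(@derive_val _ _ _ _ _ _ _ r1) (@derive_val _ _ _ _ _ _ _ r2).
by rewrite -(@derive_val _ _ _ _ _ _ _ i1) (@derive_val _ _ _ _ _ _ _ i2).
Qed.

Lemma eq_deriveC r f g l : f =1 g -> deriveC r f l -> deriveC r g l.
Proof. by move=> /funext ->. Qed.

Lemma is_derive_ext (f g : R^o -> R^o) (r df dg : R^o) :
  f =1 g -> df = dg -> is_derive r (1 : R^o) f df -> is_derive r (1 : R^o) g dg.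
Proof. by move=> /funext -> ->. Qed.

Lemma deriveC_cst r (a : C) : deriveC r (fun=> a) 0.
Proof. by split; exact: is_derive_cst. Qed.

Let ReD (a b : C) : complex.Re (a + b) = complex.Re a + complex.Re b.
Proof. by case: a b => [? ?] []. Qed.
Let ImD (a b : C) : complex.Im (a + b) = complex.Im a + complex.Im b.
Proof. by case: a b => [? ?] []. Qed.
Let ReM (a b : C) : complex.Re (a * b) =
  complex.Re a * complex.Re b - complex.Im a * complex.Im b.
Proof. by case: a b => [? ?] []. Qed.
Let ImM (a b : C) : complex.Im (a * b) =
  complex.Re a * complex.Im b + complex.Im a * complex.Re b.
Proof. by case: a b => [? ?] []. Qed.

Let ReJ (a : C) : complex.Re a^* = complex.Re a. Proof. by case: a. Qed.
Let ImJ (a : C) : complex.Im a^* = - complex.Im a. Proof. by case: a. Qed.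

Lemma deriveCD r f g l m : deriveC r f l -> deriveC r g m ->
  deriveC r (fun s => f s + g s) (l + m).
Proof.
move=> [f1 f2] [g1 g2]; split.
  by apply: is_derive_ext (is_deriveD f1 g1) => [s|]; rewrite ReD.
by apply: is_derive_ext (is_deriveD f2 g2) => [s|]; rewrite ImD.
Qed.

Lemma deriveCM r f g l m : deriveC r f l -> deriveC r g m ->
  deriveC r (fun s => f s * g s) (l * g r + f r * m).
Proof.
move=> [f1 f2] [g1 g2]; split.
  apply: is_derive_ext (is_deriveB (is_deriveM f1 g1) (is_deriveM f2 g2)) => [s|].
    by rewrite ReM.
  by rewrite ReD !ReM /GRing.scale /=; ring.
apply: is_derive_ext (is_deriveD (is_deriveM f1 g2) (is_deriveM f2 g1)) => [s|].
  by rewrite ImM.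
by rewrite ImD !ImM /GRing.scale /=; ring.
Qed.

Lemma deriveC_conj r f l : deriveC r f l -> deriveC r (fun s => (f s)^*) l^*.
Proof.
move=> [f1 f2]; split.
  by apply: is_derive_ext f1 => [s|]; rewrite ReJ.
by apply: is_derive_ext (is_deriveN f2) => [s|]; rewrite ImJ.
Qed.

Lemma deriveC_sum r (I : Type) (q : seq I) (f : I -> R^o -> C) (l : I -> C) :
  (forall i, deriveC r (f i) (l i)) ->
  deriveC r (fun s => \sum_(i <- q) f i s) (\sum_(i <- q) l i).
Proof.
move=> fl; elim: q => [|i q IHq].
  by rewrite big_nil; apply: eq_deriveC (deriveC_cst r 0) => s; rewrite big_nil.
by rewrite big_cons; apply: eq_deriveC (deriveCD (fl i) IHq) => s; rewrite big_cons.
Qed.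

Definition deriveCmx m n (r : R^o) (f : R^o -> 'M[C]_(m, n)) (l : 'M[C]_(m, n)) : Prop :=
  forall i j, deriveC r (fun s => f s i j) (l i j).

Lemma deriveCmx_unique m n r (f : R^o -> 'M[C]_(m, n)) l l' :
  deriveCmx r f l -> deriveCmx r f l' -> l = l'.
Proof.
by move=> fl fl'; apply/matrixP => i j; exact: deriveC_unique (fl i j) (fl' i j).
Qed.

Lemma deriveCmxM m n k r (f : R^o -> 'M[C]_(m, n)) (g : R^o -> 'M[C]_(n, k)) l d :
  deriveCmx r f l -> deriveCmx r g d ->
  deriveCmx r (fun s => f s *m g s) (l *m g r + f r *m d).
Proof.
move=> fl gd i j; have := deriveC_sum (index_enum 'I_n) (fun a => deriveCM (fl i a) (gd a j)).
rewrite !mxE -big_split /=; apply: eq_deriveC => s; by rewrite mxE.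
Qed.

Lemma deriveCmx_trC m n r (f : R^o -> 'M[C]_(m, n)) l :
  deriveCmx r f l -> deriveCmx r (fun s => (f s)^t*) (l^t*).
Proof.
move=> fl i j; rewrite !mxE; apply: eq_deriveC (deriveC_conj (fl j i)) => s.
by rewrite !mxE.
Qed.

Lemma deriveCmx_toC p (c : R^o -> cmx R p) r w :
  is_derive r (1 : R^o) c w -> deriveCmx r (fun s => toC (c s)) (toC w).
Proof.
move=> cw i j; split.
  apply: is_derive_ext
    (is_derive_linear_comp (h := [the {linear cmx R p -> R^o} of mxcoord i j \o fst]) _ cw).
  - by move=> s; rewrite /= mxE.
  - by rewrite mxE.
  - move=> x; apply: (continuous_comp (f := fst)); [exact: cvg_fst|exact: coord_continuous].
apply: is_derive_ext
  (is_derive_linear_comp (h := [the {linear cmx R p -> R^o} of mxcoord i j \o snd]) _ cw).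
- by move=> s; rewrite /= mxE.
- by rewrite mxE.
- move=> x; apply: (continuous_comp (f := snd)); [exact: cvg_snd|exact: coord_continuous].
Qed.

End Derivations.

(** * The one-parameter group through an involutive permutation matrix and its Hamiltonian *)

Section Rotation.
Local Open Scope sesquilinear_scope.
Variables (R : realType) (p : nat).
Local Notation C := R[i].
Variables (s : 'I_p -> 'I_p) (sK : involutive s).

(* [half_refl] is the orthogonal projection on the -1 eigenspace of the
   permutation matrix of [s], which is therefore [exp (i pi half_refl)]. *)
Definition half_refl : 'M[R]_p := 2^-1 *: (1%:M - \matrix_(i, j) (s i == j)%:R).

Local Notation Q := (map_mx (real_complex R) half_refl).

Lemma half_refl_idem : Q *m Q = Q.
Proof.
rewrite -map_mxM; congr map_mx; rewrite /half_refl; set S := \matrix_(i, j) _.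
have SS : S *m S = 1%:M.
  apply/matrixP => i j; rewrite !mxE (bigD1 (s i)) //= !mxE eqxx mul1r sK.
  rewrite big1 ?addr0 // => k ki; rewrite !mxE eq_sym (negPf ki) mul0r //.
rewrite -scalemxAl -scalemxAr scalerA mulmxBl !mulmxBr SS mul1mx mulmx1 mul1mx.
by apply/matrixP => i j; rewrite !mxE; field.
Qed.

Lemma half_refl_adj : Q^t* = Q.
Proof.
apply/matrixP => i j; rewrite !mxE (conjc_real _ : _^* = _).
by rewrite (can2_eq sK sK) [j == s i]eq_sym [j == i]eq_sym.
Qed.

(* For [c = cos a] and [d = sin a] this is [exp (i a half_refl)]. *)
Definition rot (c d : R) : 'M[C]_p := 1%:M + Complex (c - 1) d *: Q.

Lemma rot_adj c d : (rot c d)^t* = 1%:M + Complex (c - 1) (- d) *: Q.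
Proof.
rewrite /rot linearD /= map_mxD trmx1 map_mx1 linearZ /= map_mxZ half_refl_adj //.
Qed.

Lemma rot_unitary c d : c ^+ 2 + d ^+ 2 = 1 -> rot c d \is unitarymx.
Proof.
move=> cd; apply/unitarymxP; rewrite rot_adj /rot mulmxDl !mulmxDr !mul1mx mulmx1.
rewrite -scalemxAl -!scalemxAr half_refl_idem scalerA -addrA -!scalerDl.
suff -> : Complex (c - 1) (- d) +
    (Complex (c - 1) d + Complex (c - 1) d * Complex (c - 1) (- d)) = 0 :> C.
  by rewrite scale0r addr0.
by apply/eqP; rewrite eq_complex /=; apply/andP; split; apply/eqP; nra.
Qed.

(** Since Q is idempotent, [rotA X] is [Q, [Q, X]] and [rotB X] is [iQ, X]; conjugation by exp(i a
    Q) has only these two terms besides X. *)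
Definition rotA (X : 'M[C]_p) : 'M[C]_p := Q *m X + X *m Q - 2 *: (Q *m X *m Q).
Definition rotB (X : 'M[C]_p) : 'M[C]_p := 'i%C *: (Q *m X - X *m Q).

Lemma rot_conj c d X : c ^+ 2 + d ^+ 2 = 1 ->
  rot c d *m X *m (rot c d)^t* = X + (c - 1)%:C%C *: rotA X + d%:C%C *: rotB X.
Proof.
move=> cd; rewrite rot_adj /rot /rotA /rotB mulmxDl mul1mx -scalemxAl.
rewrite mulmxDr mulmx1 mulmxDl -!scalemxAr -scalemxAl scalerA.
have -> : Complex (c - 1) (- d) * Complex (c - 1) d = - 2 * (c - 1)%:C%C :> C.
  by apply/eqP; rewrite eq_complex /=; apply/andP; split; apply/eqP; nra.
have -> : Complex (c - 1) d = (c - 1)%:C%C + 'i%C * d%:C%C :> C.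
  by apply/eqP; rewrite eq_complex /=; apply/andP; split; apply/eqP; ring.
have -> : Complex (c - 1) (- d) = (c - 1)%:C%C - 'i%C * d%:C%C :> C.
  by apply/eqP; rewrite eq_complex /=; apply/andP; split; apply/eqP; ring.
move: (Q *m X *m Q) (Q *m X) (X *m Q) ('i%C : C) ((c - 1)%:C%C : C) (d%:C%C : C).
move=> K K1 K2 ii c' d'; by apply/matrixP => i j; rewrite !mxE; ring.
Qed.

(** The right-hand side is the derivative in a of that of [rot_conj] for c = cos a, d = sin a, which
    makes [rotB] the velocity field at every time. *)
Lemma rotB_conj c d X : c ^+ 2 + d ^+ 2 = 1 ->
  rotB (rot c d *m X *m (rot c d)^t*) = c%:C%C *: rotB X - d%:C%C *: rotA X.
Proof.
move=> cd; rewrite rot_conj // /rotA /rotB; move: half_refl_idem; move: Q => P PP.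
have ii : 'i%C * 'i%C = -1 :> C by rewrite -expr2 sqr_i.
move: ('i%C : C) ii => ii iiE.
have L1 : P *m (P *m X) = P *m X by rewrite mulmxA PP.
have L2 : P *m (X *m P) = P *m X *m P by rewrite mulmxA.
have L3 : P *m (P *m X *m P) = P *m X *m P by rewrite !mulmxA PP.
have R2 : X *m P *m P = X *m P by rewrite -mulmxA PP.
have R3 : P *m X *m P *m P = P *m X *m P by rewrite -mulmxA PP.
rewrite !(mulmxDl, mulmxDr) -!scalemxAl -!scalemxAr.
rewrite !(mulmxDl, mulmxDr, mulmxN, mulNmx) -!scalemxAl -!scalemxAr L1 L2 L3 R2 R3.
have -> : (c - 1)%:C%C = c%:C%C - 1 :> C by rewrite rmorphB.
move: (P *m X) (X *m P) (c%:C%C : C) (d%:C%C : C) (P *m X *m P) => K1 K2 c' d' K.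
apply/matrixP => i j; rewrite !mxE.
move: (K i j) (K1 i j) (K2 i j) => k k1 k2.
transitivity (ii * c' * (k1 - k2) + ii * ii * d' * (k1 + k2 - 2 * k)); first by ring.
by rewrite iiE; ring.
Qed.

(** The angle is scaled so that time one is the half turn, where exp(i a Q) becomes the permutation
    matrix. *)
Definition flow (r : R) (x : cmx R p) : cmx R p :=
  ofC (rot (cos (pi * r)) (sin (pi * r)) *m toC x *m
       (rot (cos (pi * r)) (sin (pi * r)))^t*).

Lemma flow0 x : flow 0 x = x.
Proof.
rewrite /flow mulr0 cos0 sin0 rot_conj; last by rewrite expr1n expr0n addr0.
by rewrite subrr !scale0r !addr0 toCK.
Qed.

Lemma flow1 x : flow 1 x = (mxsub s s x.1, mxsub s s x.2).
Proof.
rewrite /flow mulr1 cospi sinpi.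
have RE : rot (-1) 0 = \matrix_(i, j) (s i == j)%:R.
  apply/matrixP => i j; rewrite !mxE; apply/eqP; rewrite eq_complex /=.
  by apply/andP; split; apply/eqP; case: eqP => _; case: eqP => _ /=; field.
have RA : (rot (-1) 0)^t* = rot (-1) 0 by rewrite rot_adj oppr0.
rewrite RA RE.
have -> : (\matrix_(i, j) (s i == j)%:R) *m toC x *m (\matrix_(i, j) (s i == j)%:R) =
    mxsub s s (toC x).
  apply/matrixP => i j; rewrite mxE (bigD1 (s j)) // big1 => [|k kj].
    rewrite [X in _ * X]mxE sK eqxx mulr1 mxE (bigD1 (s i)) // big1 => [|k ki].
      by rewrite mxE eqxx mul1r [RHS]mxE /= !addr0.
    by rewrite [X in X * _]mxE eq_sym (negPf ki) mul0r.
  by rewrite [X in _ * X]mxE (can2_eq sK sK) (negPf kj) mulr0.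
by apply: injective_projections; apply/matrixP => i j; rewrite !mxE.
Qed.

Lemma smooth_flow (U : normedModType R) (L : {linear U -> R^o}) (F : U -> cmx R p) :
  continuous L -> smoothCmx (fun x => toC (F x)) -> smooth (fun x => flow (L x) (F x)).
Proof.
move=> cL sF.
have cl : continuous ([the {linear U -> R^o} of ( *:%R (pi : R)) \o L]).
  by move=> x; apply: (@continuousZl_tmp R R^o); exact: cL.
have [sc ss] := smooth_cos_sin cl.
have sR : smoothCmx (fun x => rot (cos (pi * L x)) (sin (pi * L x))).
  move=> i j; apply: (eq_smoothC (G := fun x =>
      (1%:M : 'M[C]_p) i j + Complex (cos (pi * L x) - 1) (sin (pi * L x)) * Q i j)).
    by move=> x; rewrite !mxE.
  apply: smoothCD; first exact: smoothC_cst.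
  apply: smoothCM; last exact: smoothC_cst.
  by split=> //=; apply: smoothD sc _; exact: smooth_cst.
by apply: smooth_ofC; apply: smoothCmxM; [exact: smoothCmxM|exact: smoothCmx_trC].
Qed.

Lemma is_derive_flow (r : R^o) (x : cmx R p) :
  is_derive r (1 : R^o) (fun q : R^o => flow q x) (pi *: ofC (rotB (toC (flow r x)))).
Proof.
have ofCD (A B : 'M[C]_p) : ofC (A + B) = ofC A + ofC B.
  by apply: injective_projections; apply/matrixP => i j; rewrite !mxE;
    case: (A i j) (B i j) => [? ?] [].
have ofCZ (a : R) (A : 'M[C]_p) : ofC (a%:C%C *: A) = a *: ofC A.
  by apply: injective_projections; apply/matrixP => i j; rewrite !mxE;
    case: (A i j) => [? ?] /=; rewrite mul0r ?subr0 ?addr0.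
have fE : (fun q : R^o => flow q x) = fun q : R^o =>
    x + (cos (pi * q) - 1 : R^o) *: ofC (rotA (toC x)) +
    (sin (pi * q) : R^o) *: ofC (rotB (toC x)).
  apply/funext => q; rewrite /flow rot_conj ?cos2Dsin2 //.
  rewrite 2!ofCD.
  rewrite !ofCZ.
  by rewrite toCK.
rewrite ofCK rotB_conj ?cos2Dsin2 // ofCD ofCZ -scaleN1r.
have -> : -1 = (-1)%:C%C :> C by rewrite rmorphN.
rewrite !ofCZ scalerDr !scalerA.
have dl : is_derive (r : R) (1 : R) (fun q : R => pi * q) pi.
  by have := is_deriveZ pi (is_derive_id (r : R) (1 : R)); rewrite /GRing.scale /= mulr1.
have dc : is_derive r (1 : R^o) (fun q : R^o => cos (pi * q) - 1 : R^o)
    (- (pi * sin (pi * r)) : R^o).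
  have dcl := @is_derive1_comp R cos (fun q => pi * q) r _ _ (is_derive_cos (pi * r)) dl.
  apply: (is_derive_eq (is_deriveB dcl (is_derive_cst (1 : R) (r : R) (1 : R)))).
  by rewrite subr0 mulNr mulrC.
have ds : is_derive r (1 : R^o) (fun q : R^o => sin (pi * q) : R^o)
    (pi * cos (pi * r) : R^o).
  have dsl := @is_derive1_comp R sin (fun q => pi * q) r _ _ (is_derive_sin (pi * r)) dl.
  by apply: (is_derive_eq dsl); rewrite mulrC.
rewrite fE; have h := is_deriveD (is_deriveD (is_derive_cst x r (1 : R^o))
  (is_derive_scale (ofC (rotA (toC x))) dc)) (is_derive_scale (ofC (rotB (toC x))) ds).
by apply: (is_derive_eq h); rewrite add0r addrC mulrN1 mulNr.
Qed.

Variable t : R.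
Hypotheses (p1 : (1 < p)%N) (t0 : 0 < t).
Local Notation lambda := (gr2_spectrum p t).
Local Notation orbit := (coadjoint_orbit lambda).

Lemma flow_orbit r x : orbit x -> orbit (flow r x).
Proof.
move=> /(orbit_frame p1 t0)[V [xV Vt]].
have uU := @rot_unitary _ (sin (pi * r)) (cos2Dsin2 (pi * r)).
pose W := rot (cos (pi * r)) (sin (pi * r)) *m V.
have WW : toC (flow r x) = W *m W^t*.
  rewrite ofCK xV /W trC_mul; move: (rot _ _) => U; move: (U^t*) (V^t*) => U' V'.
  by rewrite !mulmxA.
apply: (frame_orbit p1 WW); rewrite /W trC_mul.
move: (unitarymxPl uU) Vt; move: (rot _ _) => U; move: (U^t*) (V^t*) => U' V' UU VV.
by rewrite -mulmxA (mulmxA U') UU mul1mx VV.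
Qed.

(** On the orbit x / t is an orthogonal projection; [tangent_lift] differentiates these two
    equations. *)
Lemma orbit_quadratic x : orbit x ->
  (toC x)^t* = toC x /\ toC x *m toC x = t%:C%C *: toC x.
Proof.
move=> /(orbit_frame p1 t0)[V [-> Vt]]; split; first by rewrite trC_mul trmxCK.
by rewrite -mulmxA (mulmxA (V^t*) V) Vt mul_scalar_mx -scalemxAr.
Qed.

(* Differentiating [x^2 = t x] gives [x w + w x = t w], hence [x w x = 0] and
   [w = [Y, x]] with [Y = (w x - x w) / t^2]. *)
Lemma tangent_lift (c : R^o -> cmx R p) (x w : cmx R p) :
  smooth_curve orbit x c -> is_derive (0 : R^o) (1 : R^o) c w ->
  exists Y, skew_hermitian Y /\ bracket Y (toC x) = toC w.
Proof.
move=> [_ cM c0] cw; have dc := deriveCmx_toC cw.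
have wh : (toC w)^t* = toC w.
  apply: deriveCmx_unique (deriveCmx_trC dc) _ => i j.
  apply: eq_deriveC (dc i j) => r.
  by rewrite (orbit_quadratic (cM r)).1.
have wq : toC w *m toC x + toC x *m toC w = t%:C%C *: toC w.
  have := deriveCmxM dc dc; rewrite c0 => dcc.
  apply: deriveCmx_unique dcc _ => i j.
  have := deriveCM (deriveC_cst 0 (t%:C%C)) (dc i j).
  rewrite mul0r add0r => h; rewrite [X in deriveC _ _ X]mxE; apply: eq_deriveC h => r.
  by rewrite (orbit_quadratic (cM r)).2 [RHS]mxE.
have [xh xq] : (toC x)^t* = toC x /\ toC x *m toC x = t%:C%C *: toC x.
  by rewrite -c0; exact: orbit_quadratic.
have tn : t%:C%C != 0 :> C by rewrite (inj_eq (@complexI R)) gt_eqF.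
have tr : (t%:C%C : C)^* = t%:C%C := conjc_real t.
move: (toC x) (toC w) (t%:C%C : C) wh wq xh xq tn tr => X W u wh wq xh xq tn tr.
have XWX : X *m W *m X = 0.
  have : X *m (W *m X + X *m W) = u *: (X *m W) by rewrite wq scalemxAr.
  rewrite mulmxDr (mulmxA X X) xq -scalemxAl => /(canRL (addrK _)).
  by rewrite subrr mulmxA.
exists ((u * u)^-1 *: (W *m X - X *m W)); split.
  have sY : (W *m X - X *m W)^t* = - (W *m X - X *m W).
    by rewrite [_^T]raddfB /= map_mxB !trC_mul wh xh opprB.
  have ru : ((u * u)^-1)^* = (u * u)^-1 by rewrite fmorphV rmorphM /= tr.
  rewrite /skew_hermitian is_hermitianmxE expr1 scaleN1r [_^T]linearZ /= map_mxZ sY.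
  by rewrite scalerN opprK; apply/eqP; congr (_ *: _); exact/esym.
rewrite /bracket -scalemxAl -scalemxAr -scalerBr mulmxBl mulmxBr.
rewrite mulmxA XWX -(mulmxA W X X) xq (mulmxA X X W) xq -scalemxAr -scalemxAl.
rewrite subr0 sub0r opprK -scalerDr wq !scalerA -mulrA mulVf ?scale1r //.
by rewrite mulf_neq0.
Qed.

Definition generator : 'M[C]_p := (pi%:C%C * 'i%C) *: Q.

(** This is the real part of tr(i G x) for G = [generator]; only [x.1] enters because [half_refl] is
    real. *)
Definition hamiltonian (x : cmx R p) : R^o := - pi * \tr (half_refl *m x.1).

Lemma hamiltonian_is_linear : linear hamiltonian.
Proof.
move=> a x y; rewrite /hamiltonian /= mulmxDr -scalemxAr !raddfD /= mxtraceZ mulrDr.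
by rewrite mulrCA.
Qed.

(** Cyclicity gives tr(x [G, Y]) = tr(G [Y, x]) = tr(G w), so pairing with the vector of the
    generator is the differential of a linear function. *)
Lemma kks_generator x v w : bracket generator (toC x) = toC v ->
  (exists Y, skew_hermitian Y /\ bracket Y (toC x) = toC w) ->
  kks x v w = hamiltonian w.
Proof.
move=> gv [Y [sY Yw]]; have sG : skew_hermitian generator.
  rewrite /skew_hermitian is_hermitianmxE expr1 scaleN1r [_^T]linearZ /= map_mxZ half_refl_adj.
  rewrite -scaleNr; apply/eqP; congr (_ *: _).
  by apply/eqP; rewrite eq_complex /=; apply/andP; split; apply/eqP; ring.
rewrite (kksE sG gv sY Yw) mxtraceZ.
have trE (X K L : 'M[C]_p) : \tr (X *m bracket K L) = \tr (K *m bracket L X).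
  rewrite /bracket !mulmxBr !raddfB /=; congr (_ - _).
    by rewrite mxtrace_mulC -mulmxA.
  by rewrite mulmxA mxtrace_mulC.
rewrite trE Yw.
rewrite /generator -scalemxAl mxtraceZ mulrA.
have -> : 'i%C * (pi%:C%C * 'i%C) = (- pi)%:C%C :> C.
  by apply/eqP; rewrite eq_complex /=; apply/andP; split; apply/eqP; ring.
rewrite /hamiltonian -[RHS]/(complex.Re (- pi * \tr (half_refl *m w.1))%:C%C).
have -> : \tr (Q *m toC w) = Complex (\tr (half_refl *m w.1)) (\tr (half_refl *m w.2)).
  have -> : toC w = map_mx (real_complex R) w.1 + 'i%C *: map_mx (real_complex R) w.2.
    by apply/matrixP => i j; rewrite !mxE [LHS]complexE.
  rewrite mulmxDr -scalemxAr -!map_mxM raddfD /= mxtraceZ !trace_map_mx.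
  by rewrite [RHS]complexE.
by rewrite /= mul0r subr0.
Qed.

HB.instance Definition _ :=
  GRing.isLinear.Build R (cmx R p) R^o _ hamiltonian hamiltonian_is_linear.

Lemma hamiltonian_continuous : continuous hamiltonian.
Proof.
apply: smooth_continuous; apply: (smooth_eq (g := fun x : cmx R p =>
    \sum_i \sum_j ((- pi * half_refl i j : R^o) * x.1 j i : R^o))).
  move=> x; rewrite /hamiltonian mulr_sumr; apply: eq_bigr => i _.
  by rewrite mxE mulr_sumr; apply: eq_bigr => j _; rewrite mulrA.
do 2!(apply: smooth_sum => ? _); apply: smoothM; first exact: smooth_cst.
apply: (smooth_mxcoord (L := [the {linear cmx R p -> 'M[R]_p} of fst])).
by move=> x; exact: cvg_fst.
Qed.

(** Conjugation by exp(i pi r Q) is the flow of the linear function [hamiltonian], constant in time,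
    and reaches the permutation at r = 1. *)
Lemma permutation_hamiltonian :
  hamiltonian_diffeo orbit (@kks R p) (fun x => (mxsub s s x.1, mxsub s s x.2)).
Proof.
exists (fun z => hamiltonian z.2), (fun z => flow z.1 z.2); split.
- apply: smooth_on_smooth.
  apply: (@smooth_linear R _ _ [the {linear (R^o * cmx R p)%type -> R^o} of hamiltonian \o snd]).
  by move=> z; apply: continuous_comp; [exact: cvg_snd|exact: hamiltonian_continuous].
- apply: smooth_on_smooth.
  apply: (smooth_flow (L := [the {linear (R^o * cmx R p)%type -> R^o} of fst])).
    by move=> z; exact: cvg_fst.
  apply: (smoothCmx_toC (F := [the {linear (R^o * cmx R p)%type -> cmx R p} of snd])).
  by move=> z; exact: cvg_snd.
- by move=> x _; rewrite flow0 flow1.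
- move=> r x Ox; split; first exact: flow_orbit.
  exists (pi *: ofC (rotB (toC (flow r x)))); split; last exact: is_derive_flow.
  have := flow_orbit r Ox; move: (flow r x) => y Oy; split.
    (* The flow line through [y] is the curve that shows tangency. *)
    exists (fun q : R^o => flow q y); split; last first.
      by have := is_derive_flow 0 y; rewrite flow0.
    split=> [|q|]; [|exact: flow_orbit|exact: flow0].
    apply: smooth_on_smooth.
    apply: (smooth_flow (L := [the {linear R^o -> R^o} of idfun])).
      by move=> z; exact: cvg_id.
    by move=> i j; exact: smoothC_cst.
  move=> c w sc cw; rewrite (@kks_generator y _ w).
  - exact: is_derive_linear_comp hamiltonian_continuous cw.
  - rewrite /bracket /generator -scalemxAl -scalemxAr -scalerBr -scalerA.
    rewrite -/(rotB (toC y)); move: (rotB _) => K.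
    apply/matrixP => i j; rewrite !mxE; case: (K i j) => a b.
    by apply/eqP; rewrite eq_complex /= !mul0r subr0 addr0 !eqxx.
  - exact: tangent_lift sc cw.
Qed.

End Rotation.

(** * Displacement *)

Section Displacement.
Local Open Scope sesquilinear_scope.
Variables (R : realType) (p : nat).
Local Notation C := R[i].

(** The squared diagonal as a real polynomial in the entries of [x], without a frame, which gives
    its continuity; for a Hermitian minor the trace of the square is the sum of the squared moduli
    of the entries. *)
Definition polygon_fun m (hm : (m <= p)%N) (x : cmx R p) : R :=
  let w := widen_ord hm in
  2 * (\sum_i \sum_j (x.1 (w i) (w j) ^+ 2 + x.2 (w i) (w j) ^+ 2)) -
  (\sum_i x.1 (w i) (w i)) ^+ 2.

Lemma polygon_funE m (hm : (m <= p)%N) (x : cmx R p) (V : 'M[C]_(p, 2)) :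
  toC x = V *m V^t* -> (polygon_fun hm x)%:C%C = polygon_diag m V.
Proof.
move=> xV; have [AW WG] := leading_gram hm V; rewrite -xV in AW.
have hA : (leading hm (toC x))^t* = leading hm (toC x) by rewrite AW trC_mul trmxCK.
have -> : polygon_diag m V = 2 * \tr (leading hm (toC x) *m leading hm (toC x)) -
    \tr (leading hm (toC x)) ^+ 2.
  rewrite /polygon_diag -WG AW; move: (rowsub _ V) => W; move: (W^t*) => W'.
  by rewrite -!mulmxA !(mxtrace_mulC W') !mulmxA.
rewrite /polygon_fun rmorphB rmorphM rmorphXn /= !rmorph_sum /=; congr (_ * _ - _ ^+ 2).
- by rewrite rmorph_nat.
- rewrite -{2}hA /mxtrace; apply: eq_bigr => i _; rewrite mxE rmorph_sum.
  apply: eq_bigr => j _; rewrite !mxE.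
  by apply/eqP; rewrite eq_complex /=; apply/andP; split; apply/eqP; ring.
- apply: eq_bigr => i _; have /matrixP/(_ i i) := hA; rewrite !mxE.
  move=> /eqP; rewrite eq_complex /= => /andP[_ /eqP h].
  by apply/eqP; rewrite eq_complex /= eqxx /=; apply/eqP; lra.
Qed.

Lemma polygon_fun_continuous m (hm : (m <= p)%N) :
  continuous (polygon_fun hm : cmx R p -> R^o).
Proof.
have c1 i j : smooth (fun x : cmx R p => x.1 i j : R^o).
  apply: (smooth_mxcoord (L := [the {linear cmx R p -> 'M[R]_p} of fst])).
  by move=> x; exact: cvg_fst.
have c2 i j : smooth (fun x : cmx R p => x.2 i j : R^o).
  apply: (smooth_mxcoord (L := [the {linear cmx R p -> 'M[R]_p} of snd])).
  by move=> x; exact: cvg_snd.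
apply: smooth_continuous; apply: smoothD; last first.
  by apply: smoothN; apply: smoothM; apply: smooth_sum => i _; exact: c1.
apply: smoothM; first exact: smooth_cst.
apply: smooth_sum => i _; apply: smooth_sum => j _.
by apply: smoothD; exact: smoothM.
Qed.

(** For a Hermitian G the second hypothesis reads |G_00 - G_11|^2 + 4 |G_01|^2 = 0. *)
Lemma herm_scalar (G : 'M[C]_2) : G^t* = G ->
  2 * \tr (G *m G) - \tr G ^+ 2 = 0 -> G = (G 0 0)%:M.
Proof.
move=> hG; have G10 : G 1 0 = (G 0 1)^* by rewrite -{1}hG !mxE.
have G00 : G 0 0 = (G 0 0)^* by rewrite -{1}hG !mxE.
have G11 : G 1 1 = (G 1 1)^* by rewrite -{1}hG !mxE.
rewrite !mxtrace2 !mulmx2E G10.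
have -> : 2 * (G 0 0 * G 0 0 + G 0 1 * (G 0 1)^* + ((G 0 1)^* * G 0 1 + G 1 1 * G 1 1)) -
    (G 0 0 + G 1 1) ^+ 2 =
    (G 0 0 - G 1 1) * (G 0 0 - G 1 1)^* + 4 * (G 0 1 * (G 0 1)^*).
  by rewrite rmorphB /= -G00 -G11; ring.
move/eqP; rewrite paddr_eq0 ?mul_conj_ge0 ?(mulr_ge0 (ler0n _ 4) (mul_conj_ge0 _)) //.
rewrite mul_conj_eq0 mulf_eq0 mul_conj_eq0 pnatr_eq0 /= subr_eq0.
move=> /andP[/eqP e1 /eqP e2]; apply/matrixP.
by apply: ord2P; apply: ord2P; rewrite [RHS]mxE /= ?mulr1n ?mulr0n // ?G10 ?e2 ?rmorph0.
Qed.

Lemma scalar_polygon_diag k (V : 'M[C]_(p, 2)) (a : C) :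
  gram k V = a%:M -> polygon_diag k V = 0.
Proof.
by rewrite /polygon_diag => ->; rewrite !mxtrace2 !mulmx2E !mxE /= ?mulr1n ?mulr0n; ring.
Qed.

Lemma polygon_diag_scalar k (V : 'M[C]_(p, 2)) :
  polygon_diag k V = 0 -> exists a, gram k V = a%:M.
Proof. by move=> /(herm_scalar (gram_herm k V)) ->; eexists. Qed.

(** A single row gives a sum of rank at most one, with eigenvalues 0 and the squared length of the
    row. *)
Lemma polygon_diag1 (i : 'I_p) (V : 'M[C]_(p, 2)) : i = 0%N :> nat ->
  polygon_diag 1 V = (row i V *m (row i V)^t*) 0 0 ^+ 2.
Proof.
move=> i0; rewrite /polygon_diag; have -> : gram 1 V = 0 + (row i V)^t* *m row i V.
  have := gramS i V; rewrite i0 => ->; congr (_ + _).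
  by rewrite /gram big_pred0.
rewrite mxtrace_sqrD_rank1 add0r mxtrace_rank1 !mulmx0 mul0mx.
by rewrite linear0 [X in 2 * (_ + 2 * X + _)]mxE; move: (fun_of_matrix _ _ _) => n; ring.
Qed.

Variable t : R.
Hypotheses (p1 : (1 < p)%N) (t0 : 0 < t).
Local Notation lambda := (gr2_spectrum p t).
Local Notation orbit := (coadjoint_orbit lambda).

Lemma fiber_frame (x y : cmx R p) (V : 'M[C]_(p, 2)) : orbit x ->
  toC x = V *m V^t* -> gc_fiber (@gc_system R p lambda x) y ->
  exists W, [/\ toC y = W *m W^t*, W^t* *m W = (t%:C%C)%:M & same_gc V W].
Proof.
move=> Ox xV [Oy yx]; have [W [yW Wt]] := orbit_frame p1 t0 Oy.
exists W; split; [exact: yW|exact: Wt|move=> k kp].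
apply/(leading_eigenvaluesP kp); rewrite -yW -xV.
exact: (gc_systemP Oy Ox).1.
Qed.

Lemma same_polygon_diag k (V W : 'M[C]_(p, 2)) : same_gc V W -> (k <= p)%N ->
  polygon_diag k W = polygon_diag k V.
Proof. by move=> VW /VW[t1 t2]; rewrite /polygon_diag t1 t2. Qed.

(** A point of the moved fiber has a frame [rowsub s W]; if it also lies in the closure of the
    fiber, its diagonals are those of V by continuity. *)
Lemma displaceable_by_permutation (s : 'I_p -> 'I_p) (x : cmx R p) (V : 'M[C]_(p, 2)) :
  involutive s -> orbit x -> toC x = V *m V^t* ->
  (forall W, same_gc V W ->
    ~ forall k, (k <= p)%N -> polygon_diag k (rowsub s W) = polygon_diag k V) ->
  displaceable orbit (@kks R p) (gc_fiber (@gc_system R p lambda x)).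
Proof.
move=> sK Ox xV noW; exists (fun y => (mxsub s s y.1, mxsub s s y.2)).
split; first exact: permutation_hamiltonian.
rewrite -subset0 => _ [[y Yy <-] cl]; have [W [yW _ VW]] := fiber_frame Ox xV Yy.
apply: (noW W VW) => k kp; set z := (_, _) in cl.
have zW : toC z = rowsub s W *m (rowsub s W)^t*.
  have -> : toC z = mxsub s s (toC y) by apply/matrixP => i j; rewrite !mxE.
  by rewrite yW; apply/matrixP => i j; rewrite !mxE; apply: eq_bigr => l _; rewrite !mxE.
rewrite -(polygon_funE kp zW) -(polygon_funE kp xV); congr (_%:C)%C.
(* A closed level set that contains the fiber, hence also its closure. *)
pose D := (polygon_fun kp : cmx R p -> R^o) @^-1` [set (polygon_fun kp x : R^o)].
have clD : closed D.
  apply: closed_comp; first by move=> q _; exact: polygon_fun_continuous.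
  exact: closed_eq.
suff : closure D z by rewrite -((closure_id D).1 clD).
apply: closureS cl => q Yq.
have [U [qU _ VU]] := fiber_frame Ox xV Yq.
rewrite /D /=; apply: (@complexI R).
by rewrite (polygon_funE kp qU) (polygon_funE kp xV) (same_polygon_diag VU).
Qed.

(** For k <= p the reversed index is always in range, so the default of [insubd] is never taken. *)
Definition reverse_below (k : nat) (i : 'I_p) : 'I_p :=
  if (i < k)%N then insubd i (k - i.+1)%N else i.

Lemma reverse_belowE k i : (k <= p)%N ->
  reverse_below k i = (if i < k then k - i.+1 else i)%N :> nat.
Proof.
move=> kp; rewrite /reverse_below; case: ifP => // ik; rewrite val_insubd.
by rewrite (leq_trans _ kp) //; lia.
Qed.

Lemma reverse_belowK k : (k <= p)%N -> involutive (reverse_below k).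
Proof.
move=> kp i; apply/val_inj; rewrite /= !reverse_belowE //.
by case: (ltnP i k) => ik; [rewrite ifT|rewrite ifN]; lia.
Qed.

(** After the reversal, the last [k] of the first [l] rows are the original first [k] rows, and
    their order does not affect the sum. *)
Lemma gram_reverse k l (V : 'M[C]_(p, 2)) : (k <= l <= p)%N ->
  gram l (rowsub (reverse_below l) V) =
  gram (l - k) (rowsub (reverse_below l) V) + gram k V.
Proof.
move=> /andP[kl lp]; rewrite /gram (bigID (fun i : 'I_p => (i < l - k)%N)) /=.
congr (_ + _); first by apply: eq_bigl => i; lia.
rewrite [RHS](reindex_inj (inv_inj (reverse_belowK lp))) /=.
apply: eq_big => [i|i _]; last by rewrite !row_rowsub.
by rewrite reverse_belowE //; case: ltnP; lia.
Qed.

Lemma displaceable_reverse k l (x : cmx R p) (V : 'M[C]_(p, 2)) :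
  orbit x -> toC x = V *m V^t* -> (k <= l <= p)%N ->
  polygon_diag k V = 0 -> polygon_diag l V = 0 -> polygon_diag (l - k) V != 0 ->
  displaceable orbit (@kks R p) (gc_fiber (@gc_system R p lambda x)).
Proof.
move=> Ox xV klp zk zl nz; have [kl lp] := andP klp.
apply: (displaceable_by_permutation (reverse_belowK lp) Ox xV) => W VW WV.
have [a Wk] : exists a, gram k W = a%:M.
  by apply: polygon_diag_scalar; rewrite (same_polygon_diag VW) // (leq_trans kl).
have [b Wl] : exists b, gram l (rowsub (reverse_below l) W) = b%:M.
  by apply: polygon_diag_scalar; rewrite WV.
have lkp : (l - k <= p)%N := leq_trans (leq_subr k l) lp.
case/eqP: nz; rewrite -(WV _ lkp).
(* By [gram_reverse], the first l - k rows of the reversed frame sum to a difference of two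
   scalars. *)
apply: (@scalar_polygon_diag _ _ (b - a)).
by rewrite raddfB /= -Wl -Wk (gram_reverse _ klp) addrK.
Qed.

Lemma displaceable_first_edge (x : cmx R p) (V : 'M[C]_(p, 2)) :
  orbit x -> toC x = V *m V^t* -> V^t* *m V = (t%:C%C)%:M -> polygon_diag 1 V = 0 ->
  displaceable orbit (@kks R p) (gc_fiber (@gc_system R p lambda x)).
Proof.
move=> Ox xV Vt z1; pose i0 := Ordinal (ltnW p1).
(* Not all rows vanish, since their squared lengths add up to tr(V^* V) = 2 t. *)
have [j nj] : exists j, (row j V *m (row j V)^t*) 0 0 != 0.
  apply: contrapT => /forallNP V0.
  have : \tr (V^t* *m V) = 0.
    rewrite mxtrace_mulC; apply: big1 => j _; have /negP := V0 j; rewrite negbK => /eqP.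
    by rewrite -[RHS]/(0 : C) => <-; rewrite !mxE; apply: eq_bigr => l _; rewrite !mxE.
  rewrite Vt mxtrace_scalar => /eqP; rewrite mulrn_eq0 /=.
  by rewrite (inj_eq (@complexI R)) gt_eqF.
pose s := tperm i0 j.
have sK : involutive s by exact: tpermK.
apply: (displaceable_by_permutation sK Ox xV) => W VW WV.
(* The first row of the permuted frame is row [j] of W, which is as long as row [j] of V, while the
   first diagonal of V is zero. *)
have := WV 1%N (ltnW p1); rewrite z1 (@polygon_diag1 i0) // row_rowsub tpermL.
by rewrite (gram_norm_step j VW).1 => /eqP; rewrite expf_eq0 (negPf nj).
Qed.

End Displacement.

(** Otherwise Z is closed under differences up to p. With d its least positive element, subtracting
    d from p repeatedly stays in Z and ends at p mod d, which minimality forces to be 0; so d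
    divides p, and d <= m < p leaves only d = 1. *)
Lemma prime_subtractive (p m : nat) (Z : pred nat) : prime p -> Z p ->
  (0 < m < p)%N -> Z m -> ~~ Z 1%N ->
  exists k l, [/\ (k <= l <= p)%N, Z k, Z l & ~~ Z (l - k)%N].
Proof.
move=> pp Zp /andP[m0 mp] Zm nZ1; apply: contrapT => nE.
have sub k l : (k <= l <= p)%N -> Z k -> Z l -> Z (l - k)%N.
  by move=> klp Zk Zl; apply/negPn/negP => nZ; apply: nE; exists k, l.
have exd : exists d, (0 < d)%N && Z d by exists m; rewrite m0.
case: (ex_minnP exd) => d /andP[d0 Zd] dmin.
have dm : (d <= m)%N by apply: dmin; rewrite m0.
have Zr j : (j <= p %/ d)%N -> Z (p - j * d)%N.
  elim: j => [|j IHj] jq; first by rewrite mul0n subn0.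
  have jd : (j.+1 * d <= p)%N.
    by apply: leq_trans (leq_trunc_div p d); rewrite leq_mul2r jq orbT.
  have -> : (p - j.+1 * d = p - j * d - d)%N by lia.
  by apply: sub (IHj (ltnW jq)) => //; lia.
have := Zr _ (leqnn _); have -> : (p - p %/ d * d = p %% d)%N.
  by rewrite {1}(divn_eq p d) addKn.
have [dp _|r0 Zrd] := posnP (p %% d).
  have := (primeP pp).2 d; rewrite /dvdn dp eqxx => /(_ isT) /orP[] /eqP dE; last by lia.
  by move: Zd nZ1; rewrite dE => ->.
by have := dmin (p %% d)%N; rewrite r0 Zrd => /(_ isT); rewrite leqNgt ltn_pmod.
Qed.

Theorem theoremE (R : realType) (p : nat) (t : R)
    (u : gc_nc_index (gr2_spectrum p t) -> R) :
  prime p -> 0 < t ->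
  gc_polytope u ->
  lagrangian (coadjoint_orbit (gr2_spectrum p t)) (@kks R p) (gc_fiber u) ->
  ~ (exists n : nat, diffeomorphic (gc_fiber u) (@torus R n)) ->
  displaceable (coadjoint_orbit (gr2_spectrum p t)) (@kks R p) (gc_fiber u).
Proof.
move=> pp t0 [x Ox <-] _ nT; have p1 := prime_gt1 pp.
have [V [xV Vt]] := orbit_frame p1 t0 Ox.
have [z1|n1] := eqVneq (polygon_diag 1 V) 0.
  exact: displaceable_first_edge xV Vt z1.
(* The full sum is the scalar t, so p belongs to the set Z of the overview. *)
have Zp : polygon_diag p V = 0.
  by apply: (@scalar_polygon_diag _ _ _ _ (t%:C%C)); rewrite gram_full.
case: (pselect (exists2 m, (0 < m < p)%N & polygon_diag m V = 0)) => [[m m0p zm]|nz].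
  have [] := @prime_subtractive p m (fun k => polygon_diag k V == 0) pp _ m0p _ n1.
  - exact/eqP.
  - exact/eqP.
  - move=> k [l [klp /eqP zk /eqP zl nzlk]].
    exact: displaceable_reverse Ox xV klp zk zl nzlk.
(* No partial sum strictly between 0 and p is scalar, so the fiber is a torus, a contradiction. *)
case: nT; exists #|slots V|; apply: fiber_torus => // k k0p.
by apply/eqP => zk; apply: nz; exists k.
Qed.
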